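(* Let $k,m$ be positive integers with $k\equiv0\pmod4$, and let $R_0=R(4m\,\kappa(k,m))$. Then the linear map $$\mathcal D:J^{Spez}_{k,m}(\mathcal O_K)\longrightarrow M_k\oplus\bigoplus_{1\le\nu\le R_0}S_{k+2\nu},\qquad \mathcal D(\phi)=\bigl(D_\nu\phi\bigr)_{0\le\nu\le R_0},$$ is injective.
   Context: Notation: $\mathcal H$ is the upper half plane, $e(x)=e^{2\pi i x}$, $K=\mathbb Q(i)$, $\mathcal O_K=\mathbb Z[i]$, $\mathcal O_K^\times=\{\pm1,\pm i\}$, $N(x)=x\bar x$, $\mathcal O_K^\sharp=\frac i2\mathcal O_K$. For integers $k,m$, $\epsilon\in\mathcal O_K^\times$, $M=\begin{pmatrix}a&b\\c&d\end{pmatrix}\in SL(2,\mathbb Z)$ and $\phi$ a function on $\mathcal H\times\mathbb C^2$: $(\phi|_{k,m}\epsilon M)(\tau,z_1,z_2)=\epsilon^{-k}(c\tau+d)^{-k}e^{-2\pi i m c z_1z_2/(c\tau+d)}\phi\bigl(M\tau,\tfrac{\epsilon z_1}{c\tau+d},\tfrac{\bar\epsilon z_2}{c\tau+d}\bigr)$, $M\tau=\frac{a\tau+b}{c\tau+d}$; for $\lambda,\mu\in\mathcal O_K$, $(\phi|_m[\lambda,\mu])(\tau,z_1,z_2)=e^{2\pi i m(N(\lambda)\tau+\bar\lambda z_1+\lambda z_2)}\phi(\tau,z_1+\lambda\tau+\mu,z_2+\bar\lambda\tau+\bar\mu)$. For positive integers $k,m$, $J_{k,m}(\mathcal O_K)$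 is the space of holomorphic $\phi:\mathcal H\times\mathbb C^2\to\mathbb C$ with $\phi|_{k,m}\epsilon M=\phi$ for all $\epsilon\in\mathcal O_K^\times$, $M\in SL(2,\mathbb Z)$, $\phi|_m[\lambda,\mu]=\phi$ for all $\lambda,\mu\in\mathcal O_K$, and with a Fourier expansion $\phi=\sum_{n\ge0}\sum_{r\in\mathcal O_K^\sharp,\ nm\ge N(r)}c_\phi(n,r)\,e(n\tau+rz_1+\bar rz_2)$. $J^{Spez}_{k,m}(\mathcal O_K)$ is the subspace of $\phi$ whose $c_\phi(n,r)$ depends only on $nm-N(r)$. Write $\phi=\sum_{\alpha,\beta\ge0}\chi_{\alpha,\beta}(\tau)z_1^\alpha z_2^\beta$ and $\phi_0=\sum_{\nu\ge0}\chi_{\nu,\nu}(\tau)(z_1z_2)^\nu$. Let $L_{k,m}=8\pi i m\partial_\tau-\frac{2k-2}{z_1}\partial_{z_2}-\frac{2k-2}{z_2}\partial_{z_1}-4\partial_{z_1}\partial_{z_2}$, $\tilde D_\nu=L_{k+2\nu-2,m}\circ\cdots\circ L_{k,m}$ ($\tilde D_0=\mathrm{id}$), $D_\nu\phi(\tau)=(\tilde D_\nu\phi_0)(\tau,0,0)$; $D_0\phi\in M_k$ and $D_\nu\phi\in S_{k+2\nu}$ for $\nu\ge1$, where $M_w$, $S_w$ are modular forms and cusp forms of weight $w$ for $SL(2,\mathbb Z)$. $\kappa(k,m)=\bigl[\frac{4m^2(k-1)}{3}\prod_{p\mid4m}(1-p^{-2})+\frac m2\bigr]$ (product over primes, $[\cdot]$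 integer part). $r(d)$ is the number of $(x,y)\in\mathbb Z^2$ with $x^2+y^2=d$, and for $4m\mid l$, $R(l)=\sum_{0\le n\le l/(4m)}\sum_{0\le d\le4mn}r(d)$. *)

(* Defs.v *)
From Stdlib Require Import Reals ZArith Znumtheory List Arith Bool ClassicalEpsilon.
Import ListNotations.
Open Scope R_scope.

Definition CC : Type := (R * R)%type.
Definition Cre (z : CC) : R := fst z.
Definition Cim (z : CC) : R := snd z.
Definition RtoC (x : R) : CC := (x, 0).
Definition C0 : CC := (0, 0).
Definition C1 : CC := (1, 0).
Definition Ci : CC := (0, 1).
Definition Cadd (z w : CC) : CC := (Cre z + Cre w, Cim z + Cim w).
Definition Copp (z : CC) : CC := (- Cre z, - Cim z).
Definition Csub (z w : CC) : CC := Cadd z (Copp w).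
Definition Cmul (z w : CC) : CC :=
  (Cre z * Cre w - Cim z * Cim w, Cre z * Cim w + Cim z * Cre w).
Definition Cinv (z : CC) : CC :=
  let n := Cre z * Cre z + Cim z * Cim z in (Cre z / n, - Cim z / n).
Definition Cdiv (z w : CC) : CC := Cmul z (Cinv w).
Definition Cconj (z : CC) : CC := (Cre z, - Cim z).
Definition Cnorm (z : CC) : R := sqrt (Cre z * Cre z + Cim z * Cim z).
Fixpoint Cpow (z : CC) (n : nat) : CC :=
  match n with O => C1 | S n' => Cmul z (Cpow z n') end.
Definition ZtoC (a : Z) : CC := RtoC (IZR a).
Definition NtoC (n : nat) : CC := RtoC (INR n).
Definition gauss (a b : Z) : CC := (IZR a, IZR b).

Definition Cexp (z : CC) : CC := (exp (Cre z) * cos (Cim z), exp (Cre z) * sin (Cim z)).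
Definition e (z : CC) : CC := Cexp (Cmul (Cmul (RtoC (2 * PI)) Ci) z).

Definition inH (t : CC) : Prop := 0 < Cim t.

Definition unitK (eps : CC) : Prop :=
  eps = C1 \/ eps = Copp C1 \/ eps = Ci \/ eps = Copp Ci.

Definition Cderiv_at (f : CC -> CC) (z l : CC) : Prop :=
  forall eps, 0 < eps -> exists delta, 0 < delta /\
    forall h, h <> C0 -> Cnorm h < delta ->
      Cnorm (Csub (Cdiv (Csub (f (Cadd z h)) (f z)) h) l) < eps.

(* the complex derivative of f at z (the unique l with Cderiv_at f z l,
   whenever f is complex differentiable at z) *)
Definition Cderiv (f : CC -> CC) (z : CC) : CC :=
  epsilon (inhabits C0) (fun l => Cderiv_at f z l).

Definition holo3 (phi : CC -> CC -> CC -> CC) : Prop :=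
  forall t z1 z2, inH t -> exists a b c : CC,
    forall eps, 0 < eps -> exists delta, 0 < delta /\
      forall h1 h2 h3, Cnorm h1 < delta -> Cnorm h2 < delta -> Cnorm h3 < delta ->
        Cnorm (Csub (Csub (phi (Cadd t h1) (Cadd z1 h2) (Cadd z2 h3)) (phi t z1 z2))
                    (Cadd (Cadd (Cmul a h1) (Cmul b h2)) (Cmul c h3)))
        <= eps * (Cnorm h1 + Cnorm h2 + Cnorm h3).

Definition slashM (k m : nat) (eps : CC) (a b c d : Z) (phi : CC -> CC -> CC -> CC)
  (t z1 z2 : CC) : CC :=
  let j := Cadd (Cmul (ZtoC c) t) (ZtoC d) in
  Cmul (Cmul (Cmul (Cinv (Cpow eps k)) (Cinv (Cpow j k)))
             (e (Copp (Cdiv (Cmul (Cmul (Cmul (NtoC m) (ZtoC c)) z1) z2) j))))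
       (phi (Cdiv (Cadd (Cmul (ZtoC a) t) (ZtoC b)) j)
            (Cdiv (Cmul eps z1) j) (Cdiv (Cmul (Cconj eps) z2) j)).

Definition slashH (m : nat) (lam mu : CC) (phi : CC -> CC -> CC -> CC) (t z1 z2 : CC) : CC :=
  Cmul (e (Cmul (NtoC m)
             (Cadd (Cadd (Cmul (Cmul lam (Cconj lam)) t) (Cmul (Cconj lam) z1))
                   (Cmul lam z2))))
       (phi t (Cadd (Cadd z1 (Cmul lam t)) mu)
              (Cadd (Cadd z2 (Cmul (Cconj lam) t)) (Cconj mu))).

(* r in O_K^# = (i/2) Z[i] = (1/2) Z[i] is encoded as r = (x + i y)/2, x y : Z;
   then N(r) = (x^2+y^2)/4 and the condition n m >= N(r) reads
   4 n m >= x^2 + y^2. *)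
Definition rOf (x y : Z) : CC := (IZR x / 2, IZR y / 2).
Definition supp (m n : nat) (x y : Z) : bool :=
  (x * x + y * y <=? 4 * Z.of_nat n * Z.of_nat m)%Z.

Definition zrange (N : Z) : list Z :=
  map (fun i => (Z.of_nat i - N)%Z) (seq 0 (Z.to_nat (2 * N + 1))).

(* all (x,y) with 4nm >= x^2+y^2 (note |x| <= 4nm for such x) *)
Definition suppList (m n : nat) : list (Z * Z) :=
  let N := (4 * Z.of_nat n * Z.of_nat m)%Z in
  filter (fun p => supp m n (fst p) (snd p))
         (list_prod (zrange N) (zrange N)).

Definition fterm (cf : nat -> Z -> Z -> CC) (n : nat) (x y : Z) (t z1 z2 : CC) : CC :=
  Cmul (cf n x y)
       (e (Cadd (Cadd (Cmul (NtoC n) t) (Cmul (rOf x y) z1)) (Cmul (Cconj (rOf x y)) z2))).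

Definition fblock (m : nat) (cf : nat -> Z -> Z -> CC) (n : nat) (t z1 z2 : CC) : CC :=
  fold_right Cadd C0 (map (fun p => fterm cf n (fst p) (snd p) t z1 z2) (suppList m n)).
Definition fblockAbs (m : nat) (cf : nat -> Z -> Z -> CC) (n : nat) (t z1 z2 : CC) : R :=
  fold_right Rplus 0 (map (fun p => Cnorm (fterm cf n (fst p) (snd p) t z1 z2)) (suppList m n)).

Fixpoint Csum (f : nat -> CC) (N : nat) : CC :=
  match N with O => f O | S N' => Cadd (Csum f N') (f N) end.

Definition has_fourier (m : nat) (phi : CC -> CC -> CC -> CC) (cf : nat -> Z -> Z -> CC) : Prop :=
  forall t z1 z2, inH t ->
    (exists l, Un_cv (fun N => sum_f_R0 (fun n => fblockAbs m cf n t z1 z2) N) l) /\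
    Un_cv (fun N => Cre (Csum (fun n => fblock m cf n t z1 z2) N)) (Cre (phi t z1 z2)) /\
    Un_cv (fun N => Cim (Csum (fun n => fblock m cf n t z1 z2) N)) (Cim (phi t z1 z2)).

Definition spez (m : nat) (cf : nat -> Z -> Z -> CC) : Prop :=
  forall n x y n' x' y',
    supp m n x y = true -> supp m n' x' y' = true ->
    (4 * Z.of_nat n * Z.of_nat m - (x * x + y * y) =
     4 * Z.of_nat n' * Z.of_nat m - (x' * x' + y' * y'))%Z ->
    cf n x y = cf n' x' y'.

Definition Jacobi (k m : nat) (phi : CC -> CC -> CC -> CC) : Prop :=
  holo3 phi /\
  (forall eps a b c d, unitK eps -> (a * d - b * c = 1)%Z ->
     forall t z1 z2, inH t -> slashM k m eps a b c d phi t z1 z2 = phi t z1 z2) /\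
  (forall l1 l2 u1 u2 : Z,
     forall t z1 z2, inH t -> slashH m (gauss l1 l2) (gauss u1 u2) phi t z1 z2 = phi t z1 z2) /\
  (exists cf, has_fourier m phi cf).

Definition JSpez (k m : nat) (phi : CC -> CC -> CC -> CC) : Prop :=
  Jacobi k m phi /\ (exists cf, has_fourier m phi cf /\ spez m cf).

Definition d1 (phi : CC -> CC -> CC -> CC) : CC -> CC -> CC -> CC :=
  fun t z1 z2 => Cderiv (fun w => phi t w z2) z1.
Definition d2 (phi : CC -> CC -> CC -> CC) : CC -> CC -> CC -> CC :=
  fun t z1 z2 => Cderiv (fun w => phi t z1 w) z2.

Definition chi (phi : CC -> CC -> CC -> CC) (al be : nat) (t : CC) : CC :=
  Cdiv (Nat.iter al d1 (Nat.iter be d2 phi) t C0 C0)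
       (NtoC (fact al * fact be)).

(* A formal series sum_{a,b} F a b (tau) z1^a z2^b is represented by F. *)
Definition FSeries := nat -> nat -> CC -> CC.

Definition phi0 (phi : CC -> CC -> CC -> CC) : FSeries :=
  fun a b => if Nat.eqb a b then chi phi a a else fun _ => C0.

(* L_{k,m} = 8 pi i m d_tau - (2k-2)/z1 d_{z2} - (2k-2)/z2 d_{z1} - 4 d_{z1} d_{z2},
   acting termwise on formal series: (1/z1) d_{z2} (z1^(a+1) z2^(b+1)) = (b+1) z1^a z2^b
   and (1/z2) d_{z1} (z1^(a+1) z2^(b+1)) = (a+1) z1^a z2^b. *)
Definition Lop (k m : nat) (F : FSeries) : FSeries :=
  fun a b t =>
    Csub (Cmul (Cmul (Cmul (RtoC (8 * PI)) Ci) (NtoC m)) (Cderiv (F a b) t))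
         (Cmul (Cadd (Cadd (Cmul (Csub (Cmul (RtoC 2) (NtoC k)) (RtoC 2)) (NtoC (S b)))
                           (Cmul (Csub (Cmul (RtoC 2) (NtoC k)) (RtoC 2)) (NtoC (S a))))
                     (Cmul (RtoC 4) (NtoC (S a * S b))))
               (F (S a) (S b) t)).

Fixpoint Dtilde (k m nu : nat) (F : FSeries) : FSeries :=
  match nu with
  | O => F
  | S nu' => Lop (k + 2 * nu') m (Dtilde k m nu' F)
  end.

Definition Dnu (k m nu : nat) (phi : CC -> CC -> CC -> CC) (t : CC) : CC :=
  Dtilde k m nu (phi0 phi) 0%nat 0%nat t.

Open Scope Z_scope.
Definition isPrimeb (p : Z) : bool :=
  andb (1 <? p)
       (forallb (fun d => negb (p mod d =? 0)) (map Z.of_nat (seq 2 (Z.to_nat p - 2)))).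
Definition primesDividing (n : Z) : list Z :=
  filter (fun p => andb (isPrimeb p) (n mod p =? 0)) (map Z.of_nat (seq 2 (Z.to_nat n))).

(* kappa(k,m) = floor( 4m^2(k-1)/3 * prod_{p | 4m} (1 - p^-2) + m/2 )
             = floor( (8 m^2 (k-1) P1 + 3 m P2) / (6 P2) ),
   P1 = prod (p^2 - 1), P2 = prod p^2 over primes p | 4m *)
Definition kappa (k m : nat) : Z :=
  let ps := primesDividing (4 * Z.of_nat m) in
  let P1 := fold_right Z.mul 1 (map (fun p => p * p - 1) ps) in
  let P2 := fold_right Z.mul 1 (map (fun p => p * p) ps) in
  let mz := Z.of_nat m in let kz := Z.of_nat k in
  (8 * mz * mz * (kz - 1) * P1 + 3 * mz * P2) / (6 * P2).

(* r(d) = #{(x,y) in Z^2 : x^2 + y^2 = d}   (for d >= 0, |x|,|y| <= d) *)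
Definition rcount (d : Z) : nat :=
  length (filter (fun p => fst p * fst p + snd p * snd p =? d)
                 (list_prod (zrange d) (zrange d))).

(* R(l) = sum_{0 <= n <= l/(4m)} sum_{0 <= d <= 4mn} r(d)   (for 4m | l) *)
Definition Rfun (m : nat) (l : Z) : nat :=
  let mz := Z.of_nat m in
  fold_right Nat.add 0%nat
    (map (fun n => fold_right Nat.add 0%nat
                     (map (fun d => rcount (Z.of_nat d))
                          (seq 0 (S (Z.to_nat (4 * mz * Z.of_nat n))))))
         (seq 0 (S (Z.to_nat (l / (4 * mz)))))).

Definition Rzero (k m : nat) : nat := Rfun m (4 * Z.of_nat m * kappa k m).
Close Scope Z_scope.

(* Main.v *)
From Stdlib Require Import Reals ZArith Arith List Bool Lia Lra Psatz ClassicalEpsilon FinFun.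
From Coquelicot Require Complex.
Require Import Defs.
Import ListNotations.
Open Scope R_scope.

(* Let [c(n, r)] be the coefficients of [f = phi - psi].  Differentiating termwise, the [n]-th
   coefficient of [D_nu f] is [sum_r c(n, r) P_nu(N(r))] with [P_nu] of degree exactly [nu], so for
   [n <= kappa] Lagrange interpolation and the Spezialschar condition give [c(n, r) = 0].  Reducing
   [r] modulo [m O_K], every remaining coefficient has [n - N(r)/m >= X] with [X] large compared
   with [k].  To conclude that [f = 0], put
     [F(t, l, u) = |f(t, l t + u, conj(l) t + conj(u))| (Im t)^(k/2) exp(-2 pi m |l|^2 Im t)],
   which is invariant under the Jacobi group.  It is bounded, say by [S], on [Im t >= 17/20], hence
   on [Im t >= 3/10], because one inversion after an integral translation leads from the second
   region to the first.  The bound at height [3/10] gives [|c(n, r)| <= const * S * exp(...)], and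
   summing the Fourier series at height [>= 17/20], where only terms of exponent [>= X] occur,
   improves the bound to [S/2].  Iterating, all coefficients vanish. *)

(* With [k2 = k/2], the threshold is [X = k2 m^2], and [kappa] is just large enough for it. The
   Euler product in [kappa] is at least 1/2, so [6 (kappa + 1) > 4 m^2 (k - 1) + 3 m]. Multiplying
   by [2m/3] and subtracting the [2 m^2] lost in reducing r modulo m leaves a discriminant
   [4nm - 4N(r)] of at least [(8/3) m^3 (2 k2 - 1)]; the summand m/2 of [kappa] pays exactly for
   that loss. This is at least [4 m X] once [k2 >= 2]. Such a size is required because, from height
   3/10 to height v, a term gains only [exp(-2 pi (v - 3/10) X)], which must beat both the weight
   ratio [(v / (3/10))^k2] and a theta sum over r of order [m^2]. The height 17/20 lies slightly
   below sqrt(3)/2, the lowest height in the fundamental domain of SL(2,Z); this slack is what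
   allows one inversion to lift everything from 3/10. Fourier coefficients are isolated by averaging
   truncated series over roots of unity, which plays the part of integration over a torus. *)
Declare Scope cc_scope.
Delimit Scope cc_scope with CC.
Infix "+" := Cadd : cc_scope.
Infix "-" := Csub : cc_scope.
Infix "*" := Cmul : cc_scope.
Infix "/" := Cdiv : cc_scope.

(** * Complex numbers: field structure, modulus, exponential *)

Lemma CC_ext (z w : CC) : Cre z = Cre w -> Cim z = Cim w -> z = w.
Proof. destruct z, w; simpl; intros; subst; reflexivity. Qed.

Ltac cc_unfold :=
  unfold Cdiv, Csub, Cadd, Cmul, Copp, Cinv, Cconj, RtoC, C0, C1, Ci, NtoC, ZtoC,
    gauss, rOf, RtoC, Cre, Cim in *; cbn [fst snd] in *.

Lemma CC_ring_theory : ring_theory C0 C1 Cadd Cmul Csub Copp (@eq CC).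
Proof. constructor; intros; apply CC_ext; cc_unfold; ring. Qed.

Lemma Cmul_inv_l z : z <> C0 -> (Cinv z * z)%CC = C1.
Proof.
intros hz; destruct z as [a b].
assert (a * a + b * b <> 0).
{ intros h; apply hz; apply CC_ext; cbn; nra. }
apply CC_ext; cc_unfold; field; auto.
Qed.

Lemma CC_field_theory : field_theory C0 C1 Cadd Cmul Csub Copp Cdiv Cinv (@eq CC).
Proof.
constructor; [exact CC_ring_theory | | reflexivity | exact Cmul_inv_l].
intros h; injection h; lra.
Qed.

Add Field CC_field : CC_field_theory.

Lemma Cnorm_Cmod z : Cnorm z = Complex.Cmod z.
Proof. unfold Cnorm, Complex.Cmod; f_equal; cc_unfold; ring. Qed.

Lemma Cnorm_ge0 z : 0 <= Cnorm z.
Proof. apply sqrt_pos. Qed.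

Lemma Cnorm_mul z w : Cnorm (z * w)%CC = Cnorm z * Cnorm w.
Proof. rewrite !Cnorm_Cmod; exact (Complex.Cmod_mult z w). Qed.

Lemma Cnorm_add z w : Cnorm (z + w)%CC <= Cnorm z + Cnorm w.
Proof. rewrite !Cnorm_Cmod; exact (Complex.Cmod_triangle z w). Qed.

Lemma Cnorm_opp z : Cnorm (Copp z) = Cnorm z.
Proof. rewrite !Cnorm_Cmod; exact (Complex.Cmod_opp z). Qed.

Lemma Cnorm_C0 : Cnorm C0 = 0.
Proof. rewrite Cnorm_Cmod; exact Complex.Cmod_0. Qed.

Lemma Cnorm_C1 : Cnorm C1 = 1.
Proof. rewrite Cnorm_Cmod; exact Complex.Cmod_1. Qed.

Lemma Cnorm_eq0 z : Cnorm z = 0 -> z = C0.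
Proof. rewrite Cnorm_Cmod; exact (Complex.Cmod_eq_0 z). Qed.

Lemma Cnorm_gt0 z : z <> C0 -> 0 < Cnorm z.
Proof.
intros hz; destruct (Rle_lt_or_eq_dec _ _ (Cnorm_ge0 z)) as [h | h]; auto.
elim hz; apply Cnorm_eq0; auto.
Qed.

Lemma Cnorm_inv z : z <> C0 -> Cnorm (Cinv z) = / Cnorm z.
Proof.
intros hz; assert (h : Cnorm (Cinv z * z)%CC = 1).
{ rewrite Cmul_inv_l by auto; apply Cnorm_C1. }
rewrite Cnorm_mul in h; apply Cnorm_gt0 in hz.
field_simplify_eq; lra.
Qed.

Lemma Cnorm_pow z n : Cnorm (Cpow z n) = Cnorm z ^ n.
Proof.
induction n as [ | n IH]; cbn; [apply Cnorm_C1 | now rewrite Cnorm_mul, IH].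
Qed.

Lemma Cnorm_RtoC x : Cnorm (RtoC x) = Rabs x.
Proof. rewrite Cnorm_Cmod; exact (Complex.Cmod_R x). Qed.

Lemma Cnorm_sqr z : Cnorm z * Cnorm z = Cre z * Cre z + Cim z * Cim z.
Proof. unfold Cnorm; apply sqrt_sqrt; nra. Qed.

Lemma Cnorm_sub z w : Cnorm (z - w)%CC <= Cnorm z + Cnorm w.
Proof. unfold Csub; rewrite <- (Cnorm_opp w); apply Cnorm_add. Qed.

Lemma Cre_le_Cnorm z : Rabs (Cre z) <= Cnorm z.
Proof.
apply Rsqr_incr_0_var; [ | apply Cnorm_ge0].
rewrite <- Rsqr_abs; unfold Rsqr; rewrite Cnorm_sqr; nra.
Qed.

Lemma Cim_le_Cnorm z : Rabs (Cim z) <= Cnorm z.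
Proof.
apply Rsqr_incr_0_var; [ | apply Cnorm_ge0].
rewrite <- Rsqr_abs; unfold Rsqr; rewrite Cnorm_sqr; nra.
Qed.

Lemma Cnorm_le_Cre_Cim z : Cnorm z <= Rabs (Cre z) + Rabs (Cim z).
Proof.
apply Rsqr_incr_0_var; [unfold Rsqr; rewrite Cnorm_sqr |
  generalize (Rabs_pos (Cre z)), (Rabs_pos (Cim z)); lra].
generalize (Rabs_pos (Cre z)), (Rabs_pos (Cim z)), (Rsqr_abs (Cre z)), (Rsqr_abs (Cim z)).
unfold Rsqr; intros; nra.
Qed.

Lemma Cexp_add z w : Cexp (z + w)%CC = (Cexp z * Cexp w)%CC.
Proof.
apply CC_ext; unfold Cexp; cc_unfold; rewrite exp_plus, ?cos_plus, ?sin_plus; ring.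
Qed.

Lemma Cexp_0 : Cexp C0 = C1.
Proof.
apply CC_ext; unfold Cexp; cc_unfold; rewrite exp_0, ?cos_0, ?sin_0; ring.
Qed.

Lemma Cnorm_Cexp z : Cnorm (Cexp z) = exp (Cre z).
Proof.
apply Rsqr_inj; [apply Cnorm_ge0 | left; apply exp_pos | ].
unfold Rsqr; rewrite Cnorm_sqr; unfold Cexp; cc_unfold.
generalize (sin2_cos2 (snd z)); unfold Rsqr; intros h.
transitivity (exp (fst z) * exp (fst z) *
  (sin (snd z) * sin (snd z) + cos (snd z) * cos (snd z))); [ring | rewrite h; ring].
Qed.

Lemma e_add z w : e (z + w)%CC = (e z * e w)%CC.
Proof. unfold e; rewrite <- Cexp_add; f_equal; ring. Qed.

Lemma e_C0 : e C0 = C1.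
Proof. unfold e; rewrite <- Cexp_0; f_equal; ring. Qed.

Lemma Cnorm_e z : Cnorm (e z) = exp (- (2 * PI * Cim z)).
Proof. unfold e; rewrite Cnorm_Cexp; f_equal; cc_unfold; ring. Qed.

(** * Convergence of complex sequences *)

Definition Ccv (u : nat -> CC) (l : CC) : Prop :=
  forall eps, 0 < eps -> exists N, forall n, (N <= n)%nat -> Cnorm (u n - l)%CC < eps.

Lemma Ccv_of_parts u l :
  Un_cv (fun n => Cre (u n)) (Cre l) -> Un_cv (fun n => Cim (u n)) (Cim l) -> Ccv u l.
Proof.
intros h1 h2 eps heps.
destruct (h1 (eps / 2)) as [N1 H1]; [lra | ].
destruct (h2 (eps / 2)) as [N2 H2]; [lra | ].
exists (max N1 N2); intros n hn.
assert (a1 := H1 n ltac:(lia)); assert (a2 := H2 n ltac:(lia)).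
apply Rle_lt_trans with (1 := Cnorm_le_Cre_Cim _).
unfold Rdist in a1, a2; cc_unfold.
unfold Rminus in a1, a2; lra.
Qed.

Lemma Ccv_le u l K : Ccv u l -> (forall n, Cnorm (u n) <= K) -> Cnorm l <= K.
Proof.
intros h hK; destruct (Rle_lt_dec (Cnorm l) K) as [ | hl]; auto.
destruct (h (Cnorm l - K)) as [N HN]; [lra | ].
specialize (HN N (le_n N)); specialize (hK N).
assert (Cnorm l <= Cnorm (u N) + Cnorm (u N - l)%CC).
{ replace l with (u N - (u N - l))%CC at 1 by ring; apply Cnorm_sub. }
lra.
Qed.

Lemma Ccv_add u v l l' : Ccv u l -> Ccv v l' -> Ccv (fun n => u n + v n)%CC (l + l')%CC.
Proof.
intros h1 h2 eps heps.
destruct (h1 (eps / 2)) as [N1 H1]; [lra | ].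
destruct (h2 (eps / 2)) as [N2 H2]; [lra | ].
exists (max N1 N2); intros n hn.
assert (a1 := H1 n ltac:(lia)); assert (a2 := H2 n ltac:(lia)).
replace (u n + v n - (l + l'))%CC with ((u n - l) + (v n - l'))%CC by ring.
apply Rle_lt_trans with (1 := Cnorm_add _ _); lra.
Qed.

Lemma Ccv_scal a u l : Ccv u l -> Ccv (fun n => a * u n)%CC (a * l)%CC.
Proof.
intros h eps heps; assert (ha := Cnorm_ge0 a).
destruct (h (eps / (Cnorm a + 1))) as [N HN]; [apply Rdiv_lt_0_compat; lra | ].
exists N; intros n hn; specialize (HN n hn).
replace (a * u n - a * l)%CC with (a * (u n - l))%CC by ring.
rewrite Cnorm_mul; assert (hb := Cnorm_ge0 (u n - l)%CC).
apply Rle_lt_trans with ((Cnorm a + 1) * Cnorm (u n - l)%CC); [nra | ].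
apply Rmult_lt_compat_l with (r := Cnorm a + 1) in HN; [ | lra].
replace ((Cnorm a + 1) * (eps / (Cnorm a + 1))) with eps in HN by (field; lra); exact HN.
Qed.

Lemma Ccv_ext u v l : (forall n, u n = v n) -> Ccv u l -> Ccv v l.
Proof. intros h hu eps heps; destruct (hu eps heps) as [N HN]; exists N; intros; rewrite <- h; auto. Qed.

(** * Finite real and complex sums over lists *)

Definition RS {A : Type} (g : A -> R) (l : list A) : R := fold_right Rplus 0 (map g l).

Definition CS {A : Type} (g : A -> CC) (l : list A) : CC := fold_right Cadd C0 (map g l).

Lemma RS_app {A : Type} (g : A -> R) (l l' : list A) : RS g (l ++ l') = RS g l + RS g l'.
Proof. unfold RS; induction l; cbn; [ring | rewrite IHl; ring]. Qed.

Lemma CS_app {A : Type} (g : A -> CC) (l l' : list A) : CS g (l ++ l') = (CS g l + CS g l')%CC.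
Proof. unfold CS; induction l; cbn; [ring | rewrite IHl; ring]. Qed.

Lemma RS_le {A : Type} (g h : A -> R) (l : list A) : (forall i, In i l -> g i <= h i) -> RS g l <= RS h l.
Proof.
unfold RS; induction l; cbn; intros H; [lra | ].
apply Rplus_le_compat; auto.
Qed.

Lemma RS_ext {A : Type} (g h : A -> R) (l : list A) : (forall i, In i l -> g i = h i) -> RS g l = RS h l.
Proof. intros H; apply Rle_antisym; apply RS_le; intros; rewrite H; auto; lra. Qed.

Lemma CS_ext {A : Type} (g h : A -> CC) (l : list A) : (forall i, In i l -> g i = h i) -> CS g l = CS h l.
Proof.
unfold CS; induction l; cbn; intros H; [reflexivity | ].
rewrite IHl by auto; rewrite H by auto; reflexivity.
Qed.

Lemma RS_ge0 {A : Type} (g : A -> R) (l : list A) : (forall i, In i l -> 0 <= g i) -> 0 <= RS g l.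
Proof.
unfold RS; induction l; cbn; intros H; [lra | ].
assert (0 <= g a) by auto; assert (0 <= fold_right Rplus 0 (map g l)) by auto; lra.
Qed.

Lemma RS_add {A : Type} (g h : A -> R) (l : list A) : RS (fun i => g i + h i) l = RS g l + RS h l.
Proof. unfold RS; induction l; cbn; [ring | rewrite IHl; ring]. Qed.

Lemma RS_scal {A : Type} (a : R) (g : A -> R) (l : list A) : RS (fun i => a * g i) l = a * RS g l.
Proof. unfold RS; induction l; cbn; [ring | rewrite IHl; ring]. Qed.

Lemma CS_add {A : Type} (g h : A -> CC) (l : list A) : CS (fun i => g i + h i)%CC l = (CS g l + CS h l)%CC.
Proof. unfold CS; induction l; cbn; [ring | rewrite IHl; ring]. Qed.

Lemma CS_scal {A : Type} (a : CC) (g : A -> CC) (l : list A) : CS (fun i => a * g i)%CC l = (a * CS g l)%CC.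
Proof. unfold CS; induction l; cbn; [ring | rewrite IHl; ring]. Qed.

Lemma CS_zero {A : Type} (g : A -> CC) (l : list A) : (forall i, In i l -> g i = C0) -> CS g l = C0.
Proof.
unfold CS; induction l; cbn; intros H; [reflexivity | ].
rewrite IHl by auto; rewrite H by auto; ring.
Qed.

Lemma Cnorm_CS {A : Type} (g : A -> CC) (l : list A) : Cnorm (CS g l) <= RS (fun i => Cnorm (g i)) l.
Proof.
unfold CS, RS; induction l; cbn; [rewrite Cnorm_C0; lra | ].
apply Rle_trans with (1 := Cnorm_add _ _); lra.
Qed.

Lemma CS_filter {A : Type} (p : A -> bool) (g : A -> CC) (l : list A) :
  CS g (filter p l) = CS (fun i => if p i then g i else C0) l.
Proof.
unfold CS; induction l; cbn; [reflexivity | ].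
destruct (p a); cbn; rewrite IHl; [reflexivity | ring].
Qed.

Lemma RS_incl {A : Type} (g : A -> R) (l l' : list A) : NoDup l -> incl l l' -> (forall i, 0 <= g i) -> RS g l <= RS g l'.
Proof.
revert l'; induction l as [ | a l IH]; intros l' nd hi hg; [apply RS_ge0; auto | ].
inversion nd as [ | b c hna hnd]; subst.
destruct (in_split a l' (hi a (in_eq _ _))) as (l1 & l2 & ->).
assert (h : RS g l <= RS g (l1 ++ l2)).
{ apply IH; auto; intros x hx.
  assert (hx' := hi x (in_cons _ _ _ hx)).
  apply in_app_or in hx'; apply in_or_app; destruct hx' as [ | [ | ]]; auto.
  subst; contradiction. }
rewrite RS_app in *; unfold RS in *; cbn; lra.
Qed.

Lemma CS_exchange {A B} (g : A -> B -> CC) l l' :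
  CS (fun a => CS (fun b => g a b) l') l = CS (fun b => CS (fun a => g a b) l) l'.
Proof.
induction l as [ | a l IH].
- cbn; symmetry; apply CS_zero; reflexivity.
- change (CS (fun b => g a b) l' + CS (fun a0 => CS (fun b => g a0 b) l') l =
    CS (fun b => g a b + CS (fun a0 => g a0 b) l) l')%CC.
  rewrite CS_add, IH; reflexivity.
Qed.

Lemma RS_exchange {A B} (g : A -> B -> R) l l' :
  RS (fun a => RS (fun b => g a b) l') l = RS (fun b => RS (fun a => g a b) l) l'.
Proof.
induction l as [ | a l IH].
- unfold RS; induction l' as [ | b l' IH']; cbn in *; [reflexivity | rewrite <- IH'; ring].
- change (RS (fun b => g a b) l' + RS (fun a0 => RS (fun b => g a0 b) l') l =
    RS (fun b => g a b + RS (fun a0 => g a0 b) l) l').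
  rewrite RS_add, IH; reflexivity.
Qed.

Lemma RS_map {A B} (f : A -> B) g l : RS g (map f l) = RS (fun a => g (f a)) l.
Proof. unfold RS; rewrite map_map; reflexivity. Qed.

Lemma CS_map {A B} (f : A -> B) g l : CS g (map f l) = CS (fun a => g (f a)) l.
Proof. unfold CS; rewrite map_map; reflexivity. Qed.

Lemma RS_list_prod {A B} (g : A -> R) (h : B -> R) l l' :
  RS (fun p => g (fst p) * h (snd p)) (list_prod l l') = RS g l * RS h l'.
Proof.
induction l as [ | a l IH]; [cbn; ring | ].
cbn [list_prod]; rewrite RS_app, RS_map, IH; cbn [fst snd]; rewrite RS_scal.
unfold RS; cbn; ring.
Qed.

(** * Absolutely convergent series of exponentials *)

(** The triple [(n, (x, y))] stands for the Fourier index (n, r) with [r = (x + i y)/2]. *)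
Definition Ix : Type := (nat * (Z * Z))%type.

Definition idx (m N : nat) : list Ix :=
  flat_map (fun n => map (pair n) (suppList m n)) (seq 0 (S N)).

Lemma idx_0 m : idx m 0 = map (pair 0%nat) (suppList m 0).
Proof. unfold idx; cbn [seq flat_map]; apply app_nil_r. Qed.

Lemma idx_S m N : idx m (S N) = idx m N ++ map (pair (S N)) (suppList m (S N)).
Proof.
unfold idx; rewrite (seq_S (S N) 0), flat_map_app; cbn [flat_map].
rewrite app_nil_r; reflexivity.
Qed.

(** For nonnegative [g] this is summability over all indices, in a form that passes through
    comparisons without naming a limit. *)
Definition Bdd (m : nat) (g : Ix -> R) : Prop := exists B, forall N, RS g (idx m N) <= B.

Lemma Bdd_le m g h : (forall i, g i <= h i) -> Bdd m h -> Bdd m g.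
Proof.
intros H [B HB]; exists B; intros N; apply Rle_trans with (2 := HB N), RS_le; auto.
Qed.

Lemma Bdd_ext m g h : (forall i, g i = h i) -> Bdd m h -> Bdd m g.
Proof. intros H; apply Bdd_le; intros i; rewrite H; lra. Qed.

Lemma series_ext m a a' l : (forall i, a i = a' i) ->
  Bdd m (fun i => Cnorm (a i)) /\ Ccv (fun N => CS a (idx m N)) l ->
  Bdd m (fun i => Cnorm (a' i)) /\ Ccv (fun N => CS a' (idx m N)) l.
Proof.
intros h [h1 h2]; split.
- revert h1; apply Bdd_ext; intros i; rewrite h; auto.
- revert h2; apply Ccv_ext; intros N; apply CS_ext; intros i _; auto.
Qed.

Lemma Bdd_add m g h : Bdd m g -> Bdd m h -> Bdd m (fun i => g i + h i).
Proof.
intros [B HB] [B' HB']; exists (B + B'); intros N; rewrite RS_add.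
specialize (HB N); specialize (HB' N); lra.
Qed.

Lemma Bdd_scal m a g : 0 <= a -> Bdd m g -> Bdd m (fun i => a * g i).
Proof.
intros ha [B HB]; exists (a * B); intros N; rewrite RS_scal.
apply Rmult_le_compat_l; auto.
Qed.

Lemma Bdd_tail m g : (forall i, 0 <= g i) -> Bdd m g ->
  forall eps, 0 < eps -> exists N0, forall N, (N0 <= N)%nat ->
  RS g (idx m N) - RS g (idx m N0) <= eps.
Proof.
intros hg [B HB] eps heps.
destruct (growing_cv (fun N => RS g (idx m N))) as [l Hl].
- intros n; rewrite idx_S, RS_app.
  assert (0 <= RS g (map (pair (S n)) (suppList m (S n)))) by (apply RS_ge0; auto); lra.
- exists B; intros x [n ->]; auto.
- destruct (Hl (eps / 2)) as [N0 H0]; [lra | ].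
  exists N0; intros N hN.
  assert (a1 := H0 N hN); assert (a2 := H0 N0 (le_n N0)); unfold Rdist in *.
  apply Rabs_def2 in a1; apply Rabs_def2 in a2; lra.
Qed.

Lemma CS_idx_tail m g N0 N : (N0 <= N)%nat ->
  Cnorm (CS g (idx m N) - CS g (idx m N0))%CC <=
  RS (fun i => Cnorm (g i)) (idx m N) - RS (fun i => Cnorm (g i)) (idx m N0).
Proof.
induction 1 as [ | N hN IH].
- replace (CS g (idx m N0) - CS g (idx m N0))%CC with C0 by ring; rewrite Cnorm_C0; lra.
- rewrite idx_S, CS_app, RS_app.
  set (l := map (pair (S N)) (suppList m (S N))).
  replace (CS g (idx m N) + CS g l - CS g (idx m N0))%CC with
    ((CS g (idx m N) - CS g (idx m N0)) + CS g l)%CC by ring.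
  apply Rle_trans with (1 := Cnorm_add _ _).
  generalize (Cnorm_CS g l); lra.
Qed.

Lemma Ccv_complete (u : nat -> CC) :
  (forall eps, 0 < eps -> exists N0, forall n, (N0 <= n)%nat -> Cnorm (u n - u N0)%CC <= eps) ->
  exists l, Ccv u l.
Proof.
intros H.
assert (HC : forall p : CC -> R, (forall z w, Rabs (p z - p w) <= Cnorm (z - w)%CC) ->
  { l | Un_cv (fun n => p (u n)) l }).
{ intros p hp; apply R_complete; intros eps heps.
  destruct (H (eps / 3)) as [N0 H0]; [lra | ].
  exists N0; intros n n' hn hn'; unfold Rdist.
  apply Rle_lt_trans with (1 := hp _ _).
  replace (u n - u n')%CC with ((u n - u N0) - (u n' - u N0))%CC by ring.
  apply Rle_lt_trans with (1 := Cnorm_sub _ _).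
  generalize (H0 n hn) (H0 n' hn'); lra. }
destruct (HC Cre) as [a Ha]; [intros z w; exact (Cre_le_Cnorm (z - w)%CC) | ].
destruct (HC Cim) as [b Hb]; [intros z w; exact (Cim_le_Cnorm (z - w)%CC) | ].
exists (a, b); apply Ccv_of_parts; auto.
Qed.

Lemma Bdd_Ccv m g : Bdd m (fun i => Cnorm (g i)) -> exists l, Ccv (fun N => CS g (idx m N)) l.
Proof.
intros hB; apply Ccv_complete; intros eps heps.
destruct (Bdd_tail m _ (fun i => Cnorm_ge0 (g i)) hB eps heps) as [N0 H0].
exists N0; intros n hn; apply Rle_trans with (1 := CS_idx_tail m g N0 n hn); auto.
Qed.

(** The tail is controlled by absolute values alone, so one [N0] serves every series [g'] that
    differs from [g] by phases. Real translations of the arguments change a Fourier series in just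
    this way, hence a single truncation is good for all translates. *)
Lemma Ccv_idx_tail m g : Bdd m (fun i => Cnorm (g i)) ->
  forall eps, 0 < eps -> exists N0, forall N l', (N0 <= N)%nat ->
  forall g', (forall i, Cnorm (g' i) = Cnorm (g i)) -> Ccv (fun N => CS g' (idx m N)) l' ->
  Cnorm (l' - CS g' (idx m N))%CC <= eps.
Proof.
intros hB eps heps.
destruct (Bdd_tail m _ (fun i => Cnorm_ge0 (g i)) hB (eps / 2)) as [N0 H0]; [lra | ].
exists N0; intros N l' hN g' hg' hl'.
apply Rnot_lt_le; intros hlt.
destruct (hl' (Cnorm (l' - CS g' (idx m N))%CC - eps)) as [N1 H1]; [lra | ].
specialize (H1 (max N N1) ltac:(lia)).
assert (h := CS_idx_tail m g' N (max N N1) ltac:(lia)).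
rewrite (RS_ext _ (fun i => Cnorm (g i))) in h by auto.
rewrite (RS_ext _ (fun i => Cnorm (g i)) (idx m N)) in h by auto.
assert (h1 := H0 (max N N1) ltac:(lia)).
assert (h2 : RS (fun i => Cnorm (g i)) (idx m N0) <= RS (fun i => Cnorm (g i)) (idx m N)).
{ clear - hN; induction hN as [ | N hN IH]; [lra | rewrite idx_S, RS_app].
  assert (0 <= RS (fun i => Cnorm (g i)) (map (pair (S N)) (suppList m (S N))));
    [apply RS_ge0; intros; apply Cnorm_ge0 | lra]. }
set (s := CS g' (idx m (max N N1))) in *; set (s' := CS g' (idx m N)) in *.
assert (Cnorm (l' - s')%CC <= Cnorm (s - l')%CC + Cnorm (s - s')%CC).
{ replace (l' - s')%CC with ((s - s') - (s - l'))%CC by ring.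
  generalize (Cnorm_sub (s - s')%CC (s - l')%CC); lra. }
lra.
Qed.

(** * Elementary estimates and termwise differentiation *)

Lemma exp_ge_1 x : 0 <= x -> 1 <= exp x.
Proof. intros h; generalize (exp_ineq1_le x); lra. Qed.

Lemma exp_le_compat x y : x <= y -> exp x <= exp y.
Proof. intros [h | ->]; [left; apply exp_increasing; auto | lra]. Qed.

Lemma exp_minus_one_bound x : Rabs (exp x - 1) <= Rabs x * exp (Rabs x).
Proof.
assert (h1 := exp_ineq1_le x); assert (h2 := exp_ineq1_le (- x)).
assert (h3 : exp x * exp (- x) = 1) by (rewrite <- exp_plus, <- exp_0; f_equal; ring).
assert (h4 := exp_pos x); assert (h5 := exp_pos (- x)).
destruct (Rle_lt_dec 0 x) as [hx | hx].
- rewrite (Rabs_right x), Rabs_right by lra; nra.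
- rewrite (Rabs_left x) by lra; rewrite Rabs_left1 by (generalize (exp_increasing x 0 hx); rewrite exp_0; lra).
  nra.
Qed.

Lemma exp_second_order x : Rabs (exp x - 1 - x) <= x * x * exp (Rabs x).
Proof.
assert (h1 := exp_ineq1_le x); assert (h2 := exp_ineq1_le (- x)).
assert (h3 : exp x * exp (- x) = 1) by (rewrite <- exp_plus, <- exp_0; f_equal; ring).
assert (h4 := exp_pos x); assert (h5 := exp_pos (- x)).
rewrite (Rabs_right (exp x - 1 - x)) by lra.
assert (h6 : exp x - 1 - x <= x * (exp x - 1)) by nra.
destruct (Rle_lt_dec 0 x) as [hx | hx].
- rewrite Rabs_right by lra; assert (exp x - 1 <= x * exp x) by nra; nra.
- rewrite Rabs_left by lra; assert (1 - exp x <= - x) by lra.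
  assert (1 <= exp (- x)) by (apply exp_ge_1; lra). nra.
Qed.

Lemma sin_le_id x : 0 <= x -> Rabs (sin x) <= x.
Proof.
intros [hx | <-]; [ | rewrite sin_0, Rabs_R0; lra].
apply Rabs_le; split; [ | left; apply sin_lt_x; auto].
destruct (Rle_lt_dec x 1).
- generalize PI2_1, (sin_gt_0 x); unfold PI2; intros; lra.
- generalize (SIN_bound x); lra.
Qed.

Lemma cos_second_order x : 0 <= 1 - cos x <= x * x / 2.
Proof.
split; [generalize (COS_bound x); lra | ].
assert (h : cos x = 1 - 2 * sin (x / 2) * sin (x / 2)).
{ rewrite <- cos_2a_sin; f_equal; field. }
assert (h1 : Rabs (sin (x / 2)) <= Rabs (x / 2)).
{ destruct (Rle_lt_dec 0 (x / 2)) as [hx | hx].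
  - rewrite (Rabs_right (x / 2)) by lra; apply sin_le_id; auto.
  - rewrite (Rabs_left (x / 2)) by lra; rewrite <- Rabs_Ropp, <- sin_neg.
    apply sin_le_id; lra. }
apply Rsqr_le_abs_1 in h1; unfold Rsqr in h1; lra.
Qed.

Lemma sin_second_order x : Rabs (sin x - x) <= x * x.
Proof.
assert (H : forall x, 0 < x -> Rabs (sin x - x) <= x * x).
{ clear x; intros x hx.
  destruct (MVT_cor2 (fun t => sin t - t) (fun t => cos t - 1) 0 x hx) as (c & hc & hc').
  { intros c _; apply derivable_pt_lim_minus;
      [apply derivable_pt_lim_sin | apply derivable_pt_lim_id]. }
  rewrite sin_0 in hc.
  replace (sin x - x) with (- (x * (1 - cos c))) by lra.
  assert (h1 := cos_second_order c); assert (h2 := COS_bound c).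
  rewrite Rabs_Ropp, Rabs_right by nra.
  assert (1 - cos c <= x); [ | nra].
  destruct (Rle_lt_dec c 2); nra. }
destruct (Rtotal_order x 0) as [hx | [-> | hx]]; auto.
- specialize (H (- x) ltac:(lra)); rewrite sin_neg in H.
  rewrite <- Rabs_Ropp; replace (- (sin x - x)) with (- sin x - - x) by ring; lra.
- rewrite sin_0, Rminus_0_r, Rabs_R0; lra.
Qed.

(** The bound must hold for all [w], not only for small ones: it is applied to [b i * h] with
    frequencies [b i] that are unbounded over the index set. *)
Lemma Cexp_second_order w :
  Cnorm (Cexp w - C1 - w)%CC <= 4 * (Cnorm w * Cnorm w) * exp (Cnorm w).
Proof.
rewrite Cnorm_sqr; assert (hr := Cre_le_Cnorm w).
apply Rle_trans with (1 := Cnorm_le_Cre_Cim _).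
destruct w as [a b]; cbn [Cre Cim fst snd] in *.
replace (Cre (Cexp (a, b) - C1 - (a, b))%CC)
  with ((exp a - 1 - a) + exp a * - (1 - cos b)) by (unfold Cexp; cc_unfold; ring).
replace (Cim (Cexp (a, b) - C1 - (a, b))%CC)
  with (exp a * (sin b - b) + (exp a - 1) * b) by (unfold Cexp; cc_unfold; ring).
assert (h1 := exp_second_order a); assert (h2 := exp_minus_one_bound a).
assert (h3 := cos_second_order b); assert (h4 := sin_second_order b).
assert (h5 : exp (Rabs a) <= exp (Cnorm (a, b))) by (apply exp_le_compat; auto).
assert (h6 : exp a <= exp (Cnorm (a, b))).
{ apply Rle_trans with (2 := h5), exp_le_compat, Rle_abs. }
assert (h7 := exp_pos a); assert (h8 := exp_pos (Rabs a)).
set (E := exp (Cnorm (a, b))) in *.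
assert (ha := Rabs_pos a); assert (hb := Rabs_pos b).
assert (ha2 : Rabs a * Rabs a = a * a) by (rewrite <- Rabs_mult; apply Rabs_right; nra).
assert (hb2 : Rabs b * Rabs b = b * b) by (rewrite <- Rabs_mult; apply Rabs_right; nra).
assert (k1 : Rabs (exp a - 1 - a) <= a * a * E) by nra.
assert (k2 : Rabs (exp a * - (1 - cos b)) <= E * (b * b / 2)).
{ rewrite Rabs_mult, Rabs_Ropp, !Rabs_right by lra; apply Rmult_le_compat; lra. }
assert (k3 : Rabs (exp a * (sin b - b)) <= E * (b * b)).
{ rewrite Rabs_mult, (Rabs_right (exp a)) by lra; apply Rmult_le_compat; try lra; apply Rabs_pos. }
assert (k4 : Rabs ((exp a - 1) * b) <= Rabs a * Rabs b * E).
{ rewrite Rabs_mult; apply Rle_trans with (Rabs a * exp (Rabs a) * Rabs b).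
  - apply Rmult_le_compat_r; auto.
  - assert (0 <= Rabs a * Rabs b) by nra; nra. }
assert (k5 : Rabs a * Rabs b <= (a * a + b * b) / 2).
{ generalize (Rle_0_sqr (Rabs a - Rabs b)); unfold Rsqr; nra. }
assert (h9 : 0 < E) by (unfold E; apply exp_pos).
generalize (Rabs_triang (exp a - 1 - a) (exp a * - (1 - cos b)))
  (Rabs_triang (exp a * (sin b - b)) ((exp a - 1) * b)); intros t1 t2.
assert (Rabs a * Rabs b * E <= (a * a + b * b) / 2 * E) by (apply Rmult_le_compat_r; lra).
assert (0 <= (a * a) * E /\ 0 <= b * b * E) by (split; nra).
lra.
Qed.

Lemma Cderiv_at_of_quadratic f w L C d : 0 < d ->
  (forall h, Cnorm h <= d -> Cnorm (f (w + h) - f w - h * L)%CC <= C * (Cnorm h * Cnorm h)) ->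
  Cderiv_at f w L.
Proof.
intros hd H eps heps.
exists (Rmin d (eps / (Rabs C + 1))); split.
{ apply Rmin_pos; [auto | apply Rdiv_lt_0_compat; auto; generalize (Rabs_pos C); lra]. }
intros h hh hlt.
assert (h1 : Cnorm h < d) by (apply Rlt_le_trans with (1 := hlt), Rmin_l).
assert (h2 : Cnorm h < eps / (Rabs C + 1)) by (apply Rlt_le_trans with (1 := hlt), Rmin_r).
assert (hn := Cnorm_gt0 h hh).
replace ((f (w + h) - f w) / h - L)%CC with ((f (w + h) - f w - h * L) * Cinv h)%CC
  by (field; auto).
rewrite Cnorm_mul, Cnorm_inv by auto.
apply Rle_lt_trans with (C * (Cnorm h * Cnorm h) * / Cnorm h).
{ apply Rmult_le_compat_r; [left; apply Rinv_0_lt_compat; auto | apply H; lra]. }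
replace (C * (Cnorm h * Cnorm h) * / Cnorm h) with (C * Cnorm h) by (field; lra).
assert (hC := Rabs_pos C); assert (hC' := Rle_abs C).
apply Rmult_lt_compat_l with (r := Rabs C + 1) in h2; [ | lra].
replace ((Rabs C + 1) * (eps / (Rabs C + 1))) with eps in h2 by (field; lra).
nra.
Qed.

Lemma Cderiv_at_unique f w L L' : Cderiv_at f w L -> Cderiv_at f w L' -> L = L'.
Proof.
intros h1 h2.
assert (h : Cnorm (L - L')%CC <= 0).
{ apply Rnot_lt_le; intros hlt; set (eps := Cnorm (L - L')%CC / 2).
  destruct (h1 eps) as (d1 & hd1 & H1); [unfold eps; lra | ].
  destruct (h2 eps) as (d2 & hd2 & H2); [unfold eps; lra | ].
  set (x := Rmin d1 d2 / 2).
  assert (hm := Rmin_pos _ _ hd1 hd2).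
  assert (hx : 0 < x) by (unfold x; lra).
  assert (hx0 : RtoC x <> C0) by (intros hh; injection hh; lra).
  assert (hxn : Cnorm (RtoC x) = x) by (rewrite Cnorm_RtoC; apply Rabs_right; lra).
  specialize (H1 (RtoC x) hx0); specialize (H2 (RtoC x) hx0); rewrite hxn in H1, H2.
  specialize (H1 ltac:(unfold x; generalize (Rmin_l d1 d2); lra)).
  specialize (H2 ltac:(unfold x; generalize (Rmin_r d1 d2); lra)).
  set (q := ((f (w + RtoC x) - f w) / RtoC x)%CC) in *.
  assert (Cnorm (L - L')%CC <= Cnorm (q - L')%CC + Cnorm (q - L)%CC).
  { replace (L - L')%CC with ((q - L') - (q - L))%CC by ring; apply Cnorm_sub. }
  unfold eps in *; lra. }
assert (h0 : (L - L')%CC = C0) by (apply Cnorm_eq0; generalize (Cnorm_ge0 (L - L')%CC); lra).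
replace L with (L' + (L - L'))%CC by ring; rewrite h0; ring.
Qed.

Lemma Cderiv_eq f w L : Cderiv_at f w L -> Cderiv f w = L.
Proof.
intros h; apply (Cderiv_at_unique f w); auto.
unfold Cderiv; apply epsilon_spec; exists L; auto.
Qed.

(* [|Re b|] and [|Im b|] are both reached by [Re (b h)] for some [h = +-1, +-i], so shifting
   the argument by these four multiples of [4 d] dominates [exp (2 d |b|)]. *)
Lemma exp_Cnorm_four_shifts b d : 0 < d ->
  exp (2 * d * Cnorm b) <=
    (Cnorm (Cexp (Cmul b (RtoC (4 * d)))) + Cnorm (Cexp (Cmul b (RtoC (- (4 * d)))))) +
    (Cnorm (Cexp (Cmul b (0, 4 * d))) + Cnorm (Cexp (Cmul b (0, - (4 * d))))).
Proof.
intros hd; rewrite !Cnorm_Cexp.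
assert (h := Cnorm_le_Cre_Cim b).
set (s1 := exp (Cre (Cmul b (RtoC (4 * d))))); set (s2 := exp (Cre (Cmul b (RtoC (- (4 * d)))))).
set (s3 := exp (Cre (Cmul b (0, 4 * d)))); set (s4 := exp (Cre (Cmul b (0, - (4 * d))))).
assert (p1 : 0 < s1) by apply exp_pos; assert (p2 : 0 < s2) by apply exp_pos.
assert (p3 : 0 < s3) by apply exp_pos; assert (p4 : 0 < s4) by apply exp_pos.
assert (H : exp (2 * d * Cnorm b) <= s1 \/ exp (2 * d * Cnorm b) <= s2 \/
  exp (2 * d * Cnorm b) <= s3 \/ exp (2 * d * Cnorm b) <= s4); [ | lra].
destruct b as [x y]; unfold s1, s2, s3, s4; cc_unfold.
set (n := Cnorm (x, y)) in *.
assert (hn : 2 * d * n <= 2 * d * (Rabs x + Rabs y)) by (apply Rmult_le_compat_l; lra).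
destruct (Rle_lt_dec (Rabs y) (Rabs x)) as [hxy | hxy].
- assert (2 * d * (Rabs x + Rabs y) <= 4 * d * Rabs x) by nra.
  destruct (Rle_lt_dec 0 x).
  + rewrite (Rabs_right x) in * by lra; left; apply exp_le_compat; lra.
  + rewrite (Rabs_left x) in * by lra; right; left; apply exp_le_compat; lra.
- assert (2 * d * (Rabs x + Rabs y) <= 4 * d * Rabs y) by nra.
  destruct (Rle_lt_dec 0 y).
  + rewrite (Rabs_right y) in * by lra; do 3 right; apply exp_le_compat; lra.
  + rewrite (Rabs_left y) in * by lra; right; right; left; apply exp_le_compat; lra.
Qed.

(** Absolute convergence at the four points at distance [4 d] from [w] along the axes makes
    [T i * exp (2 d |b i|)] summable. This one majorant dominates the differentiated terms and,
    through the quadratic remainder of [Cexp], the errors of all difference quotients with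
    [|h| <= d]. *)
Lemma expseries_deriv m (A b : Ix -> CC) f w d : 0 < d ->
  (forall w', Cnorm (w' - w)%CC <= 4 * d ->
     Bdd m (fun i => Cnorm (A i * Cexp (b i * w'))%CC) /\
     Ccv (fun N => CS (fun i => A i * Cexp (b i * w'))%CC (idx m N)) (f w')) ->
  Bdd m (fun i => Cnorm (A i * b i * Cexp (b i * w))%CC) /\
  Ccv (fun N => CS (fun i => A i * b i * Cexp (b i * w))%CC (idx m N)) (Cderiv f w).
Proof.
intros hd H.
set (T := fun i => Cnorm (A i * Cexp (b i * w))%CC).
assert (hT : forall i, 0 <= T i) by (intros; apply Cnorm_ge0).
assert (HB : Bdd m (fun i => T i * exp (2 * d * Cnorm (b i)))).
{ assert (Hsh : forall h, Cnorm h <= 4 * d -> Bdd m (fun i => T i * Cnorm (Cexp (b i * h)%CC))).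
  { intros h hh; destruct (H (w + h)%CC) as [hb _].
    - replace (w + h - w)%CC with h by ring; auto.
    - revert hb; apply Bdd_ext; intros i; unfold T; rewrite <- Cnorm_mul; f_equal.
      replace (b i * (w + h))%CC with (b i * w + b i * h)%CC by ring; rewrite Cexp_add; ring. }
  assert (n1 : forall x, Rabs x = 4 * d -> Cnorm (0, x) <= 4 * d).
  { intros x hx; apply Rle_trans with (1 := Cnorm_le_Cre_Cim _).
    cbn [Cre Cim fst snd]; rewrite Rabs_R0; lra. }
  assert (r1 : Rabs (4 * d) = 4 * d) by (apply Rabs_right; lra).
  assert (r2 : Rabs (- (4 * d)) = 4 * d) by (rewrite Rabs_Ropp; auto).
  assert (q1 := Hsh (RtoC (4 * d)) ltac:(rewrite Cnorm_RtoC; lra)).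
  assert (q2 := Hsh (RtoC (- (4 * d))) ltac:(rewrite Cnorm_RtoC; lra)).
  assert (q3 := Hsh (0, 4 * d) (n1 _ r1)).
  assert (q4 := Hsh (0, - (4 * d)) (n1 _ r2)).
  refine (Bdd_le _ _ _ _ (Bdd_add _ _ _ (Bdd_add _ _ _ q1 q2) (Bdd_add _ _ _ q3 q4))).
  intros i; cbn beta; generalize (exp_Cnorm_four_shifts (b i) d hd) (hT i); intros h0 h1.
  apply Rmult_le_compat_l with (r := T i) in h0; auto; lra. }
assert (Hb : Bdd m (fun i => Cnorm (A i * b i * Cexp (b i * w))%CC)).
{ apply Bdd_scal with (a := / (2 * d)) in HB; [ | left; apply Rinv_0_lt_compat; lra].
  revert HB; apply Bdd_le; intros i.
  replace (A i * b i * Cexp (b i * w))%CC with ((A i * Cexp (b i * w)) * b i)%CC by ring.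
  rewrite Cnorm_mul; fold (T i).
  apply Rmult_le_reg_l with (2 * d); [lra | ].
  rewrite <- (Rmult_assoc (2 * d) (/ (2 * d))), Rinv_r, Rmult_1_l by lra.
  generalize (exp_ineq1_le (2 * d * Cnorm (b i))) (hT i); intros h0 h1.
  apply Rle_trans with (T i * (2 * d * Cnorm (b i))); [lra | ].
  apply Rmult_le_compat_l; lra. }
split; auto.
destruct (Bdd_Ccv m _ Hb) as [L HL].
replace (Cderiv f w) with L; auto.
symmetry; apply Cderiv_eq.
destruct HB as [B HB].
(* 16 is the factor 4 of [Cexp_second_order] times the 4 in [(d |b|)^2 <= 4 exp (d |b|)]. Of the
   majorant [exp (2 d |b|)], one half pays for [|b|^2] and the other for [exp (|b| |h|)]. *)
apply Cderiv_at_of_quadratic with (C := 16 / (d * d) * B) (d := d); auto.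
intros h hh.
assert (hs : Cnorm (w + h - w)%CC <= 4 * d) by (replace (w + h - w)%CC with h by ring; lra).
assert (hs0 : Cnorm (w - w)%CC <= 4 * d).
{ replace (w - w)%CC with C0 by ring; rewrite Cnorm_C0; lra. }
assert (HC := Ccv_add _ _ _ _ (Ccv_add _ _ _ _ (proj2 (H _ hs))
  (Ccv_scal (Copp C1) _ _ (proj2 (H _ hs0)))) (Ccv_scal (Copp h) _ _ HL)).
replace (f (w + h) - f w - h * L)%CC with (f (w + h) + Copp C1 * f w + Copp h * L)%CC by ring.
apply (Ccv_le _ _ _ HC); intros N; cbn beta.
rewrite <- !CS_scal, <- !CS_add.
apply Rle_trans with (1 := Cnorm_CS _ _).
apply Rle_trans with (16 / (d * d) * (Cnorm h * Cnorm h) *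
  RS (fun i => T i * exp (2 * d * Cnorm (b i))) (idx m N)).
2:{ assert (0 <= 16 / (d * d) * (Cnorm h * Cnorm h)).
    { apply Rmult_le_pos; [left; apply Rdiv_lt_0_compat; nra | generalize (Cnorm_ge0 h); nra]. }
    specialize (HB N); nra. }
rewrite <- RS_scal; apply RS_le; intros i _.
replace (A i * Cexp (b i * (w + h)) + Copp C1 * (A i * Cexp (b i * w)) +
  Copp h * (A i * b i * Cexp (b i * w)))%CC with
  ((A i * Cexp (b i * w)) * (Cexp (b i * h) - C1 - b i * h))%CC.
2:{ replace (b i * (w + h))%CC with (b i * w + b i * h)%CC by ring; rewrite Cexp_add; ring. }
rewrite Cnorm_mul; fold (T i).
assert (h1 := Cexp_second_order (b i * h)%CC); rewrite Cnorm_mul in h1.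
set (y := Cnorm (b i)) in *; set (x := Cnorm h) in *.
assert (hy : 0 <= y) by apply Cnorm_ge0; assert (hx : 0 <= x) by apply Cnorm_ge0.
assert (h2 : exp (y * x) <= exp (d * y)) by (apply exp_le_compat; nra).
assert (h3 : (d * y) * (d * y) <= 4 * exp (d * y)).
{ assert (h4 := exp_ineq1_le (d * y / 2)).
  replace (exp (d * y)) with (exp (d * y / 2) * exp (d * y / 2))
    by (rewrite <- exp_plus; f_equal; field).
  assert (0 <= d * y) by nra; nra. }
assert (h4 : exp (2 * d * y) = exp (d * y) * exp (d * y))
  by (rewrite <- exp_plus; f_equal; ring).
assert (h5 := exp_pos (d * y)).
assert (h6 : y * y <= / (d * d) * (4 * exp (d * y))).
{ apply Rmult_le_reg_l with (d * d); [nra | ].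
  replace (d * d * (/ (d * d) * (4 * exp (d * y)))) with (4 * exp (d * y)) by (field; lra); lra. }
replace (16 / (d * d) * (x * x) * (T i * exp (2 * d * y))) with
  (T i * (4 * (x * x) * (/ (d * d) * (4 * exp (d * y))) * exp (d * y)))
  by (rewrite h4; field; lra).
apply Rmult_le_compat_l; auto; apply Rle_trans with (1 := h1).
assert (0 <= x * x) by nra; assert (0 <= y * y) by nra.
replace (y * x * (y * x)) with (x * x * (y * y)) by ring.
rewrite <- !Rmult_assoc.
apply Rmult_le_compat; [nra | left; apply exp_pos | nra | auto].
Qed.

(** * Fourier series and the operators D_nu *)

Definition tpi : CC := Cmul (RtoC (2 * PI)) Ci.

Definition ix_r (i : Ix) : CC := rOf (fst (snd i)) (snd (snd i)).

Definition phase (i : Ix) (t z1 z2 : CC) : CC :=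
  (NtoC (fst i) * t + ix_r i * z1 + Cconj (ix_r i) * z2)%CC.

Definition jseries (m : nat) (c : Ix -> CC) (f : CC -> CC -> CC -> CC) : Prop :=
  forall t z1 z2, inH t ->
    Bdd m (fun i => Cnorm (c i * e (phase i t z1 z2))%CC) /\
    Ccv (fun N => CS (fun i => c i * e (phase i t z1 z2))%CC (idx m N)) (f t z1 z2).

(** The terms stay indexed by (n, r) although only n enters the exponential: each coefficient
    remains visible through all operations, and terms with equal n are collected only in
    [qseries_zero_block]. *)
Definition qseries (m : nat) (c : Ix -> CC) (g : CC -> CC) : Prop :=
  forall t, inH t ->
    Bdd m (fun i => Cnorm (c i * e (NtoC (fst i) * t))%CC) /\
    Ccv (fun N => CS (fun i => c i * e (NtoC (fst i) * t))%CC (idx m N)) (g t).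

Lemma jseries_of_has_fourier m phi cf : has_fourier m phi cf ->
  jseries m (fun i => cf (fst i) (fst (snd i)) (snd (snd i))) phi.
Proof.
intros H t z1 z2 ht; destruct (H t z1 z2 ht) as ((l & Hl) & Hre & Him).
set (g := fun i : Ix => (cf (fst i) (fst (snd i)) (snd (snd i)) * e (phase i t z1 z2))%CC).
assert (hC : forall N, Csum (fun n => fblock m cf n t z1 z2) N = CS g (idx m N)).
{ induction N as [ | N IH].
  - rewrite idx_0, CS_map; reflexivity.
  - rewrite idx_S, CS_app, <- IH, CS_map; reflexivity. }
assert (hR : forall N, sum_f_R0 (fun n => fblockAbs m cf n t z1 z2) N =
  RS (fun i => Cnorm (g i)) (idx m N)).
{ induction N as [ | N IH].
  - rewrite idx_0, RS_map; reflexivity.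
  - rewrite idx_S, RS_app, <- IH, RS_map; reflexivity. }
split.
- exists l; intros N; rewrite <- hR.
  apply (growing_ineq (fun N => sum_f_R0 (fun n => fblockAbs m cf n t z1 z2) N)); auto.
  intros n; rewrite !hR, idx_S, RS_app.
  assert (0 <= RS (fun i => Cnorm (g i)) (map (pair (S n)) (suppList m (S n))));
    [apply RS_ge0; intros; apply Cnorm_ge0 | lra].
- apply (Ccv_ext _ _ _ hC), Ccv_of_parts; auto.
Qed.

Lemma jseries_qseries m c f : jseries m c f -> qseries m c (fun t => f t C0 C0).
Proof.
intros H t ht; destruct (H t C0 C0 ht) as [h1 h2].
assert (h : forall i, phase i t C0 C0 = (NtoC (fst i) * t)%CC) by (intros; unfold phase; ring).
refine (series_ext _ _ _ _ _ (conj h1 h2)); intros i; rewrite h; auto.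
Qed.

Lemma jseries_d1 m c f : jseries m c f -> jseries m (fun i => c i * (tpi * ix_r i))%CC (d1 f).
Proof.
intros H t z1 z2 ht.
set (A := fun i => (c i * e (NtoC (fst i) * t + Cconj (ix_r i) * z2))%CC).
set (b := fun i => (tpi * ix_r i)%CC).
assert (hA : forall i w, (A i * Cexp (b i * w))%CC = (c i * e (phase i t w z2))%CC).
{ intros i w; unfold A, b, e.
  replace (phase i t w z2) with
    ((NtoC (fst i) * t + Cconj (ix_r i) * z2) + ix_r i * w)%CC by (unfold phase; ring).
  unfold tpi.
  replace (RtoC (2 * PI) * Ci * (NtoC (fst i) * t + Cconj (ix_r i) * z2 + ix_r i * w))%CC
    with (RtoC (2 * PI) * Ci * (NtoC (fst i) * t + Cconj (ix_r i) * z2) +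
          RtoC (2 * PI) * Ci * ix_r i * w)%CC by ring.
  rewrite Cexp_add; ring. }
destruct (expseries_deriv m A b (fun w => f t w z2) z1 1 ltac:(lra)) as [h1 h2].
{ intros w _; destruct (H t w z2 ht) as [h1 h2]; refine (series_ext _ _ _ _ _ (conj h1 h2)); intros i; rewrite hA; auto. }
assert (h : forall i, (A i * b i * Cexp (b i * z1))%CC =
  (c i * (tpi * ix_r i) * e (phase i t z1 z2))%CC).
{ intros i; transitivity (b i * (A i * Cexp (b i * z1)))%CC; [ring | rewrite hA; unfold b; ring]. }
refine (series_ext _ _ _ _ _ (conj h1 h2)); intros i; rewrite h; auto.
Qed.

Lemma jseries_d2 m c f : jseries m c f -> jseries m (fun i => c i * (tpi * Cconj (ix_r i)))%CC (d2 f).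
Proof.
intros H t z1 z2 ht.
set (A := fun i => (c i * e (NtoC (fst i) * t + ix_r i * z1))%CC).
set (b := fun i => (tpi * Cconj (ix_r i))%CC).
assert (hA : forall i w, (A i * Cexp (b i * w))%CC = (c i * e (phase i t z1 w))%CC).
{ intros i w; unfold A, b, e.
  unfold tpi, phase.
  replace (RtoC (2 * PI) * Ci * (NtoC (fst i) * t + ix_r i * z1 + Cconj (ix_r i) * w))%CC
    with (RtoC (2 * PI) * Ci * (NtoC (fst i) * t + ix_r i * z1) +
          RtoC (2 * PI) * Ci * Cconj (ix_r i) * w)%CC by ring.
  rewrite Cexp_add; ring. }
destruct (expseries_deriv m A b (fun w => f t z1 w) z2 1 ltac:(lra)) as [h1 h2].
{ intros w _; destruct (H t z1 w ht) as [h1 h2]; refine (series_ext _ _ _ _ _ (conj h1 h2)); intros i; rewrite hA; auto. }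
assert (h : forall i, (A i * b i * Cexp (b i * z2))%CC =
  (c i * (tpi * Cconj (ix_r i)) * e (phase i t z1 z2))%CC).
{ intros i; transitivity (b i * (A i * Cexp (b i * z2)))%CC; [ring | rewrite hA; unfold b; ring]. }
refine (series_ext _ _ _ _ _ (conj h1 h2)); intros i; rewrite h; auto.
Qed.

Lemma qseries_deriv m c g : qseries m c g -> qseries m (fun i => c i * (tpi * NtoC (fst i)))%CC (Cderiv g).
Proof.
intros H t ht.
set (b := fun i : Ix => (tpi * NtoC (fst i))%CC).
assert (hA : forall i w, (c i * Cexp (b i * w))%CC = (c i * e (NtoC (fst i) * w))%CC).
{ intros i w; unfold b, e, tpi; do 2 f_equal; ring. }
(* With this radius the disc of radius [4 d = Im t / 2] around [t] stays in the upper half plane. *)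
destruct (expseries_deriv m c b g t (Cim t / 8)) as [h1 h2].
{ unfold inH in ht; lra. }
{ intros w hw; destruct (H w) as [h1 h2].
  { unfold inH in *; generalize (Cim_le_Cnorm (w - t)%CC).
    replace (Cim (w - t)%CC) with (Cim w - Cim t) by (cc_unfold; ring).
    intros h; assert (h0 := Rle_trans _ _ _ h hw); generalize (Rle_abs (- (Cim w - Cim t))); rewrite Rabs_Ropp; lra. }
  refine (series_ext _ _ _ _ _ (conj h1 h2)); intros i; rewrite hA; auto. }
assert (h : forall i, (c i * b i * Cexp (b i * t))%CC =
  (c i * (tpi * NtoC (fst i)) * e (NtoC (fst i) * t))%CC).
{ intros i; transitivity (b i * (c i * Cexp (b i * t)))%CC; [ring | rewrite hA; unfold b; ring]. }
refine (series_ext _ _ _ _ _ (conj h1 h2)); intros i; rewrite h; auto.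
Qed.

Lemma qseries_ext m c c' g : (forall i, c i = c' i) -> qseries m c g -> qseries m c' g.
Proof.
intros h H t ht; destruct (H t ht) as [h1 h2]; refine (series_ext _ _ _ _ _ (conj h1 h2)); intros i; rewrite h; auto.
Qed.

Lemma qseries_scal m a c g : qseries m c g -> qseries m (fun i => a * c i)%CC (fun t => a * g t)%CC.
Proof.
intros H t ht; destruct (H t ht) as [h1 h2]; split.
- apply Bdd_scal with (a := Cnorm a) in h1; [ | apply Cnorm_ge0].
  revert h1; apply Bdd_ext; intros i; rewrite <- Cnorm_mul; f_equal; ring.
- apply Ccv_scal with (a := a) in h2; revert h2; apply Ccv_ext; intros N.
  rewrite <- CS_scal; apply CS_ext; intros i _; ring.
Qed.

Lemma jseries_add m c c' f f' : jseries m c f -> jseries m c' f' ->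
  jseries m (fun i => c i + c' i)%CC (fun t z1 z2 => f t z1 z2 + f' t z1 z2)%CC.
Proof.
intros H H' t z1 z2 ht; destruct (H t z1 z2 ht) as [h1 h2]; destruct (H' t z1 z2 ht) as [h3 h4].
split.
- refine (Bdd_le _ _ _ _ (Bdd_add _ _ _ h1 h3)); intros i; cbn beta.
  replace ((c i + c' i) * e (phase i t z1 z2))%CC with
   (c i * e (phase i t z1 z2) + c' i * e (phase i t z1 z2))%CC by ring; apply Cnorm_add.
- refine (Ccv_ext _ _ _ _ (Ccv_add _ _ _ _ h2 h4)); intros N; cbn beta.
  rewrite <- CS_add; apply CS_ext; intros i _; ring.
Qed.

Lemma jseries_opp m c f : jseries m c f ->
  jseries m (fun i => Copp (c i)) (fun t z1 z2 => Copp (f t z1 z2)).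
Proof.
intros H t z1 z2 ht; destruct (H t z1 z2 ht) as [h1 h2]; split.
- revert h1; apply Bdd_ext; intros i; rewrite <- Cnorm_opp; f_equal; ring.
- apply Ccv_scal with (a := Copp C1) in h2.
  replace (Copp (f t z1 z2)) with (Copp C1 * f t z1 z2)%CC by ring.
  revert h2; apply Ccv_ext; intros N; rewrite <- CS_scal; apply CS_ext; intros i _; ring.
Qed.

Lemma qseries_sub m c c' g g' : qseries m c g -> qseries m c' g' ->
  qseries m (fun i => c i - c' i)%CC (fun t => g t - g' t)%CC.
Proof.
intros H H' t ht; destruct (H t ht) as [h1 h2]; destruct (H' t ht) as [h3 h4].
split.
- refine (Bdd_le _ _ _ _ (Bdd_add _ _ _ h1 h3)); intros i; cbn beta.
  replace ((c i - c' i) * e (NtoC (fst i) * t))%CC with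
   (c i * e (NtoC (fst i) * t) - c' i * e (NtoC (fst i) * t))%CC by ring; apply Cnorm_sub.
- apply Ccv_scal with (a := Copp C1) in h4.
  replace (g t - g' t)%CC with (g t + Copp C1 * g' t)%CC by ring.
  refine (Ccv_ext _ _ _ _ (Ccv_add _ _ _ _ h2 h4)); intros N; cbn beta.
  rewrite <- CS_scal, <- CS_add; apply CS_ext; intros i _; ring.
Qed.

Lemma Cpow_mul z w n : Cpow (z * w)%CC n = (Cpow z n * Cpow w n)%CC.
Proof. induction n as [ | n IH]; cbn; [ring | rewrite IH; ring]. Qed.

Lemma RtoC_pow x n : Cpow (RtoC x) n = RtoC (x ^ n).
Proof.
induction n as [ | n IH]; cbn; [reflexivity | rewrite IH].
apply CC_ext; cc_unfold; ring.
Qed.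

Lemma jseries_iter_d1_d2 m c f a b : jseries m c f ->
  jseries m (fun i => c i * (Cpow (tpi * Cconj (ix_r i)) b * Cpow (tpi * ix_r i) a))%CC
    (Nat.iter a d1 (Nat.iter b d2 f)).
Proof.
intros H.
assert (E : forall c' c'' f', (forall i, c' i = c'' i) -> jseries m c' f' -> jseries m c'' f').
{ intros c' c'' f' h H' t z1 z2 ht; destruct (H' t z1 z2 ht) as [h1 h2]; refine (series_ext _ _ _ _ _ (conj h1 h2)); intros i; rewrite h; auto. }
induction a as [ | a IHa].
- induction b as [ | b IHb].
  + revert H; apply E; intros i; cbn; ring.
  + apply jseries_d2 in IHb; revert IHb; apply E; intros i; cbn; ring.
- apply jseries_d1 in IHa; revert IHa; apply E; intros i; cbn; ring.
Qed.

(* [sig i = (2 pi i)^2 N(r)], the factor by which [d_{z1} d_{z2}] acts on the term of index [i]. *)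
Definition sig (i : Ix) : R :=
  - (PI * PI) * (IZR (fst (snd i)) * IZR (fst (snd i)) + IZR (snd (snd i)) * IZR (snd (snd i))).

(** The factor that the term (n, r) acquires in the coefficient of [(z1 z2)^a] of [Dtilde nu], with
    [s = (2 pi i)^2 N(r)]. The first product is [8 pi i m] times the [2 pi i n] of the
    tau-derivative; the second is the rest of the operator, which sends the diagonal coefficient
    [a + 1] to [a]. Diagonal coefficients involve diagonal coefficients only, so one index is
    enough. *)
Fixpoint dnu_poly (k m nu a n : nat) (s : R) : R :=
  match nu with
  | O => s ^ a / INR (fact a * fact a)
  | S nu' => - (16 * PI * PI * INR m * INR n) * dnu_poly k m nu' a n s
      - ((2 * INR (k + 2 * nu') - 2) * INR (S a) + (2 * INR (k + 2 * nu') - 2) * INR (S a)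
         + 4 * INR (S a * S a)) * dnu_poly k m nu' (S a) n s
  end.

Lemma Dtilde_qseries k m c f : jseries m c f -> forall nu a,
  qseries m (fun i => c i * RtoC (dnu_poly k m nu a (fst i) (sig i)))%CC (Dtilde k m nu (phi0 f) a a).
Proof.
intros H; induction nu as [ | nu IH]; intros a.
- cbn [Dtilde]; unfold phi0; rewrite Nat.eqb_refl; unfold chi.
  assert (h := qseries_scal _ (Cinv (NtoC (fact a * fact a))) _ _ (jseries_qseries _ _ _ (jseries_iter_d1_d2 m c f a a H))).
  assert (hf : INR (fact a * fact a) <> 0).
  { apply not_0_INR; generalize (fact_neq_0 a); intros; nia. }
  assert (hf' : Cinv (NtoC (fact a * fact a)) = RtoC (/ INR (fact a * fact a))).
  { set (q := (fact a * fact a)%nat) in *; unfold NtoC; apply CC_ext; cc_unfold; field; auto. }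
  assert (h' : qseries m (fun i => c i * RtoC (dnu_poly k m 0 a (fst i) (sig i)))%CC
    (fun t => Cinv (NtoC (fact a * fact a)) * Nat.iter a d1 (Nat.iter a d2 f) t C0 C0)%CC).
  { revert h; apply qseries_ext; intros i; rewrite <- Cpow_mul, hf'.
    replace (tpi * Cconj (ix_r i) * (tpi * ix_r i))%CC with (RtoC (sig i)).
    2:{ unfold tpi, ix_r, sig; apply CC_ext; cc_unfold; field. }
    rewrite RtoC_pow; cbn [dnu_poly]; unfold Rdiv.
    set (u := sig i ^ a); set (v := / INR (fact a * fact a)).
    destruct (c i); apply CC_ext; cc_unfold; ring. }
  intros t ht; destruct (h' t ht) as [h1 h2]; split; auto.
  unfold Cdiv; replace (Nat.iter a d1 (Nat.iter a d2 f) t C0 C0 * Cinv (NtoC (fact a * fact a)))%CC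
    with (Cinv (NtoC (fact a * fact a)) * Nat.iter a d1 (Nat.iter a d2 f) t C0 C0)%CC by ring; auto.
- cbn [Dtilde]; unfold Lop.
  refine (qseries_ext _ _ _ _ _ (qseries_sub _ _ _ _ _ (qseries_scal _ _ _ _ (qseries_deriv _ _ _ (IH a)))
    (qseries_scal _ _ _ _ (IH (S a))))).
  intros i; cbn [dnu_poly].
  set (u := dnu_poly k m nu a (fst i) (sig i)); set (v := dnu_poly k m nu (S a) (fst i) (sig i)).
  unfold tpi, NtoC.
  set (n := INR (fst i)); set (x := INR (k + 2 * nu)); set (y := INR (S a)); set (y2 := INR (S a * S a)).
  set (M := INR m).
  destruct (c i); apply CC_ext; cc_unfold; ring.
Qed.

(** * Extraction of Fourier coefficients *)

Lemma NoDup_list_prod {A B} (l : list A) (l' : list B) :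
  NoDup l -> NoDup l' -> NoDup (list_prod l l').
Proof.
intros h h'; induction h as [ | a l ha hl IH]; cbn; [constructor | ].
apply NoDup_app; auto.
- apply Injective_map_NoDup; auto; intros x y E; congruence.
- intros [x y] h1 h2; apply in_map_iff in h1; destruct h1 as (z & E & _).
  apply in_prod_iff in h2; injection E; intros; subst; tauto.
Qed.

Lemma in_zrange N z : In z (zrange N) <-> (- N <= z <= N)%Z.
Proof.
unfold zrange; rewrite in_map_iff; split.
- intros (i & <- & hi); apply in_seq in hi; lia.
- intros h; exists (Z.to_nat (z + N)); split; [lia | apply in_seq; lia].
Qed.

Lemma NoDup_zrange N : NoDup (zrange N).
Proof.
unfold zrange; apply Injective_map_NoDup; [ | apply seq_NoDup].
intros i j h; lia.
Qed.

Lemma in_suppList m n x y :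
  In (x, y) (suppList m n) <-> (x * x + y * y <= 4 * Z.of_nat n * Z.of_nat m)%Z.
Proof.
unfold suppList, supp; rewrite filter_In, in_prod_iff, !in_zrange; cbn [fst snd].
rewrite Z.leb_le; split; [tauto | intros h].
assert (0 <= 4 * Z.of_nat n * Z.of_nat m)%Z by lia.
set (N := (4 * Z.of_nat n * Z.of_nat m)%Z) in *; repeat split; auto; nia.
Qed.

Lemma NoDup_suppList m n : NoDup (suppList m n).
Proof. apply NoDup_filter, NoDup_list_prod; apply NoDup_zrange. Qed.

Lemma in_block m n i : In i (map (pair n) (suppList m n)) <->
  fst i = n /\ In (snd i) (suppList m n).
Proof.
rewrite in_map_iff; split.
- intros (p & <- & hp); auto.
- destruct i as [n' p]; cbn; intros [-> hp]; exists p; auto.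
Qed.

Lemma in_idx m N i : In i (idx m N) <-> (fst i <= N)%nat /\ In (snd i) (suppList m (fst i)).
Proof.
unfold idx; rewrite in_flat_map; split.
- intros (n & hn & hi); apply in_seq in hn; apply in_block in hi.
  destruct hi as [-> hi]; split; auto; lia.
- intros [h1 h2]; exists (fst i); split; [apply in_seq; lia | apply in_block; auto].
Qed.

Lemma NoDup_idx m N : NoDup (idx m N).
Proof.
assert (hb : forall n, NoDup (map (pair n) (suppList m n))).
{ intros n; apply Injective_map_NoDup; [intros x y E; congruence | apply NoDup_suppList]. }
induction N as [ | N IH]; [rewrite idx_0; auto | rewrite idx_S].
apply NoDup_app; auto.
intros i h1 h2; apply in_idx in h1; apply in_block in h2; lia.
Qed.

Lemma CS_delta {A} (g : A -> CC) (l : list A) a : NoDup l -> In a l ->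
  (forall b, In b l -> b <> a -> g b = C0) -> CS g l = g a.
Proof.
intros nd ha h; destruct (in_split a l ha) as (l1 & l2 & ->).
apply NoDup_remove_2 in nd.
rewrite CS_app; change (CS g (a :: l2)) with (g a + CS g l2)%CC.
rewrite !CS_zero; [ring | | ]; intros b hb; apply h; try (intros ->; apply nd);
  apply in_or_app; cbn; auto.
Qed.

Lemma CS_idx_block m g n N : (n <= N)%nat ->
  CS (fun i : Ix => if (Z.of_nat (fst i) =? Z.of_nat n)%Z then g i else C0) (idx m N) =
  CS g (map (pair n) (suppList m n)).
Proof.
set (g' := fun i : Ix => if (Z.of_nat (fst i) =? Z.of_nat n)%Z then g i else C0).
assert (h0 : CS g' (map (pair n) (suppList m n)) = CS g (map (pair n) (suppList m n))).
{ apply CS_ext; intros i hi; apply in_block in hi; unfold g'.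
  rewrite (proj1 hi), Z.eqb_refl; reflexivity. }
assert (h1 : forall l, (forall i, In i l -> fst i <> n) -> CS g' l = C0).
{ intros l hl; apply CS_zero; intros i hi; unfold g'.
  destruct (Z.eqb_spec (Z.of_nat (fst i)) (Z.of_nat n)); auto.
  elim (hl i hi); lia. }
induction N as [ | N IH]; intros hn.
- replace n with 0%nat in * by lia; rewrite idx_0; auto.
- rewrite idx_S, CS_app; destruct (Nat.eq_dec n (S N)) as [E | E].
  + rewrite (h1 (idx m N)); [ | intros i hi; apply in_idx in hi; lia].
    rewrite <- E, h0; ring.
  + rewrite IH by lia; rewrite (h1 (map _ _)); [ring | ].
    intros i hi; apply in_block in hi; lia.
Qed.

Lemma e_real x : e (RtoC x) = (cos (2 * PI * x), sin (2 * PI * x)).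
Proof.
unfold e, Cexp.
replace (RtoC (2 * PI) * Ci * RtoC x)%CC with ((0, 2 * PI * x) : CC)
  by (apply CC_ext; cc_unfold; ring).
apply CC_ext; cbn [Cre Cim fst snd]; rewrite exp_0; ring.
Qed.

Lemma e_Z (d : Z) : e (RtoC (IZR d)) = C1.
Proof.
assert (h1 : e (RtoC 1) = C1).
{ rewrite e_real, Rmult_1_r, cos_2PI, sin_2PI; reflexivity. }
assert (hn : forall n, e (RtoC (INR n)) = C1).
{ induction n as [ | n IH]; [exact e_C0 | rewrite S_INR].
  replace (RtoC (INR n + 1)) with (RtoC (INR n) + RtoC 1)%CC
    by (apply CC_ext; cc_unfold; ring).
  rewrite e_add, IH, h1; ring. }
destruct (Z_le_gt_dec 0 d) as [hd | hd].
- rewrite <- (Z2Nat.id d) by auto; rewrite <- INR_IZR_INZ; auto.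
- assert (h := hn (Z.to_nat (- d))).
  rewrite INR_IZR_INZ, Z2Nat.id in h by lia.
  assert (E : (e (RtoC (IZR d)) * e (RtoC (IZR (- d))))%CC = C1).
  { rewrite <- e_add, <- e_C0; f_equal; rewrite opp_IZR; apply CC_ext; cc_unfold; ring. }
  rewrite h in E; rewrite <- E; ring.
Qed.

Lemma e_INR_mul (z : CC) n : e (RtoC (INR n) * z)%CC = Cpow (e z) n.
Proof.
induction n as [ | n IH].
- cbn [Cpow]; rewrite <- e_C0; f_equal; apply CC_ext; cc_unfold; cbn; ring.
- rewrite S_INR; cbn [Cpow]; rewrite <- IH, <- e_add; f_equal; apply CC_ext; cc_unfold; ring.
Qed.

Lemma e_real_neq1 x : 0 < Rabs x < 1 -> e (RtoC x) <> C1.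
Proof.
intros hx E.
assert (h : cos (2 * (PI * x)) = 1).
{ rewrite e_real in E; injection E; intros _ <-; f_equal; ring. }
rewrite cos_2a_sin in h.
assert (h0 : sin (PI * x) = 0) by nra.
assert (hP := PI_RGT_0).
assert (H : forall y, 0 < y < 1 -> sin (PI * y) <> 0).
{ intros y hy; assert (0 < sin (PI * y)); [apply sin_gt_0; nra | lra]. }
destruct (Rle_lt_dec 0 x) as [h1 | h1].
- rewrite Rabs_right in hx by lra; apply (H x); auto.
- rewrite Rabs_left in hx by lra; apply (H (- x)); auto.
  replace (PI * - x) with (- (PI * x)) by ring; rewrite sin_neg; lra.
Qed.

Lemma root_of_unity_sum (d : Z) (M : nat) : (0 < M)%nat -> (d <> 0)%Z ->
  (Z.abs d < Z.of_nat M)%Z ->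
  CS (fun s => e (RtoC (IZR d * (INR s / INR M)))) (seq 0 M) = C0.
Proof.
intros hM hd hdM.
assert (hM' : 0 < INR M) by (apply lt_0_INR; auto).
set (w := e (RtoC (IZR d / INR M))).
assert (hw : forall s, e (RtoC (IZR d * (INR s / INR M))) = Cpow w s).
{ intros s; unfold w; rewrite <- e_INR_mul; f_equal; apply CC_ext; cc_unfold; field; lra. }
assert (hw1 : (w - C1)%CC <> C0).
{ intros E; apply (e_real_neq1 (IZR d / INR M)).
  - unfold Rdiv; rewrite Rabs_mult, Rabs_inv, (Rabs_right (INR M)), <- abs_IZR by lra.
    rewrite INR_IZR_INZ in *; split.
    + apply Rmult_lt_0_compat; [apply IZR_lt; lia | apply Rinv_0_lt_compat; auto].
    + apply Rmult_lt_reg_r with (IZR (Z.of_nat M)); auto.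
      rewrite Rmult_assoc, Rinv_l, Rmult_1_r, Rmult_1_l by lra; apply IZR_lt; auto.
  - fold w; replace w with ((w - C1) + C1)%CC by ring; rewrite E; ring. }
assert (hs : forall n, ((w - C1) * CS (fun s => Cpow w s) (seq 0 n))%CC = (Cpow w n - C1)%CC).
{ induction n as [ | n IH]; [cbn; ring | rewrite seq_S, CS_app].
  transitivity ((w - C1) * CS (fun s => Cpow w s) (seq 0 n) + (w - C1) * Cpow w n)%CC;
    [cbn; ring | rewrite IH; cbn; ring]. }
specialize (hs M); rewrite <- (hw M) in hs.
replace (IZR d * (INR M / INR M)) with (IZR d) in hs by (field; lra).
rewrite e_Z in hs.
rewrite (CS_ext _ (fun s => Cpow w s)) by (intros; apply hw).
set (S := CS (fun s => Cpow w s) (seq 0 M)) in *.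
transitivity (Cinv (w - C1) * ((w - C1) * S))%CC.
- transitivity ((Cinv (w - C1) * (w - C1)) * S)%CC; [rewrite Cmul_inv_l by auto; ring | ring].
- rewrite hs; ring.
Qed.

Lemma CS_const {A} (a : CC) (l : list A) : CS (fun _ => a) l = (NtoC (length l) * a)%CC.
Proof.
induction l as [ | x l IH].
- apply CC_ext; cbn; ring.
- change (CS (fun _ => a) (x :: l)) with (a + CS (fun _ : A => a) l)%CC.
  rewrite IH; cbn [length]; unfold NtoC; rewrite S_INR; apply CC_ext; cc_unfold; ring.
Qed.

Lemma exists_spread {A} (l : list A) (p : A -> Z) q :
  exists M, (0 < M)%nat /\ forall i, In i l -> (Z.abs (p i - q) < Z.of_nat M)%Z.
Proof.
induction l as [ | a l (M & hM & H)]; [exists 1%nat; split; [lia | intros i []] | ].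
exists (M + S (Z.to_nat (Z.abs (p a - q))))%nat; split; [lia | ].
intros i [<- | hi]; [lia | specialize (H i hi); lia].
Qed.

(** The sums are averaged against [e (- q s / M)] over [s < M]. When [M] exceeds every [|p i - q|],
    no frequency other than [q] is congruent to [q] modulo [M], so the average isolates it exactly.
    As this [M] depends on the list, the hypothesis covers all [M]. *)
Lemma average_extract {A} (l : list A) (p : A -> Z) (a : A -> CC) K q :
  (forall M s : nat, (0 < M)%nat ->
     Cnorm (CS (fun i => a i * e (RtoC (IZR (p i) * (INR s / INR M))))%CC l) <= K) ->
  Cnorm (CS (fun i => if (p i =? q)%Z then a i else C0) l) <= K.
Proof.
intros H; destruct (exists_spread l p q) as (M & hM & hp).
assert (hM' : 0 < INR M) by (apply lt_0_INR; auto).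
set (W := CS (fun s => e (RtoC (- IZR q * (INR s / INR M))) *
  CS (fun i => a i * e (RtoC (IZR (p i) * (INR s / INR M)))) l)%CC (seq 0 M)).
assert (hW : Cnorm W <= INR M * K).
{ apply Rle_trans with (1 := Cnorm_CS _ _).
  apply Rle_trans with (RS (fun _ => K) (seq 0 M)).
  - apply RS_le; intros s _; rewrite Cnorm_mul, Cnorm_e.
    replace (exp _) with 1; [rewrite Rmult_1_l; auto | ].
    rewrite <- exp_0; f_equal; cc_unfold; ring.
  - right; clear; generalize 0%nat as b; induction M as [ | M IH]; intros b.
    + cbn; ring.
    + rewrite S_INR; change (K + RS (fun _ : nat => K) (seq (S b) M) = (INR M + 1) * K).
      rewrite IH; ring. }
assert (E : W = (NtoC M * CS (fun i => if (p i =? q)%Z then a i else C0) l)%CC).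
{ unfold W; transitivity (CS (fun s => CS (fun i => a i *
    e (RtoC (IZR (p i - q) * (INR s / INR M)))) l)%CC (seq 0 M)).
  - apply CS_ext; intros s _; rewrite <- CS_scal; apply CS_ext; intros i _.
    rewrite minus_IZR.
    replace (RtoC ((IZR (p i) - IZR q) * (INR s / INR M))) with
      (RtoC (- IZR q * (INR s / INR M)) + RtoC (IZR (p i) * (INR s / INR M)))%CC
      by (apply CC_ext; cc_unfold; ring).
    rewrite e_add; ring.
  - rewrite CS_exchange, <- CS_scal; apply CS_ext; intros i hi; rewrite CS_scal.
    destruct (Z.eqb_spec (p i) q) as [h | h].
    + rewrite (CS_ext _ (fun _ => C1)), CS_const, length_seq; [ring | ].
      intros s _; rewrite h, Z.sub_diag, Rmult_0_l; exact e_C0.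
    + rewrite root_of_unity_sum; auto; [ring | lia]. }
rewrite E, Cnorm_mul in hW; unfold NtoC in hW; rewrite Cnorm_RtoC, Rabs_right in hW by lra.
apply Rmult_le_reg_l in hW; auto.
Qed.

(** The block is estimated at [t = i]. Moving to [(x, 1)] multiplies the terms by [e (n x)], and as
    the full series vanishes there, every long truncation is at most [eps], uniformly in [x];
    averaging over [x] carries the bound to a single block. *)
Lemma qseries_zero_block m c g : qseries m c g -> (forall t, inH t -> g t = C0) ->
  forall n, CS c (map (pair n) (suppList m n)) = C0.
Proof.
intros H hg n.
assert (hi : forall x, inH (x, 1)) by (intros; unfold inH; cbn; lra).
set (a := fun i : Ix => (c i * e (NtoC (fst i) * Ci))%CC).
destruct (H Ci (hi 0)) as [hB hC].
assert (hE : CS a (map (pair n) (suppList m n)) =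
  (e (NtoC n * Ci) * CS c (map (pair n) (suppList m n)))%CC).
{ rewrite <- CS_scal; apply CS_ext; intros i hi'; apply in_block in hi'.
  unfold a; rewrite (proj1 hi'); ring. }
assert (h0 : Cnorm (CS a (map (pair n) (suppList m n))) <= 0).
{ apply le_epsilon; intros eps heps; rewrite Rplus_0_l.
  destruct (Ccv_idx_tail m a hB eps heps) as [N0 H0].
  rewrite <- (CS_idx_block m a n (max n N0)) by lia.
  apply (average_extract (idx m (max n N0)) (fun i => Z.of_nat (fst i))); intros M s hM.
  set (x := INR s / INR M).
  assert (hph : forall i : Ix, (a i * e (RtoC (IZR (Z.of_nat (fst i)) * x)))%CC =
    (c i * e (NtoC (fst i) * (x, 1)))%CC).
  { intros i; unfold a; rewrite <- INR_IZR_INZ; set (u := RtoC (INR (fst i) * x)).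
    replace (NtoC (fst i) * (x, 1))%CC with (NtoC (fst i) * Ci + u)%CC
      by (unfold u; apply CC_ext; cc_unfold; ring).
    rewrite e_add; ring. }
  destruct (H (x, 1) (hi x)) as [_ hC']; rewrite hg in hC' by auto.
  rewrite (CS_ext _ (fun i => c i * e (NtoC (fst i) * (x, 1)))%CC) by (intros; apply hph).
  set (g' := fun i : Ix => (c i * e (NtoC (fst i) * (x, 1)))%CC) in *.
  rewrite <- Cnorm_opp.
  replace (Copp (CS g' (idx m (max n N0)))) with (C0 - CS g' (idx m (max n N0)))%CC by ring.
  apply H0; auto; [lia | ].
  intros i; unfold g'; rewrite <- hph, Cnorm_mul, (Cnorm_e (RtoC _)).
  replace (exp _) with 1; [ring | rewrite <- exp_0; f_equal; cc_unfold; ring]. }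
assert (h1 : CS a (map (pair n) (suppList m n)) = C0).
{ apply Cnorm_eq0; generalize (Cnorm_ge0 (CS a (map (pair n) (suppList m n)))); lra. }
rewrite hE in h1.
set (S := CS c (map (pair n) (suppList m n))) in *.
assert (hne : e (NtoC n * Ci)%CC <> C0).
{ intros E; generalize (exp_pos (- (2 * PI * Cim (NtoC n * Ci)%CC))).
  rewrite <- Cnorm_e, E, Cnorm_C0; lra. }
transitivity (Cinv (e (NtoC n * Ci)%CC) * (e (NtoC n * Ci) * S))%CC.
- transitivity ((Cinv (e (NtoC n * Ci)) * e (NtoC n * Ci)) * S)%CC;
    [rewrite Cmul_inv_l by auto; ring | ring].
- rewrite h1; ring.
Qed.

Lemma small_multiple u B q : (Z.abs u < B)%Z -> u = (B * q)%Z -> q = 0%Z.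
Proof.
intros h ->; rewrite Z.abs_mul in h; destruct (Z.eq_dec q 0); auto; exfalso; nia.
Qed.

(** A Cauchy estimate: shifting [t] by a real [x] and [(z1, z2)] by [(w, conj w)] only multiplies
    each term by a phase. One averaging parameter suffices because the three integers of an index
    are packed into one frequency. *)
Lemma jseries_coef_bound m c f t z1 z2 K : jseries m c f -> inH t ->
  (forall (x : R) (w : CC), Cnorm (f (t + RtoC x) (z1 + w) (z2 + Cconj w))%CC <= K) ->
  forall i, In (snd i) (suppList m (fst i)) -> Cnorm (c i * e (phase i t z1 z2))%CC <= K.
Proof.
intros H ht hK i0 hi0.
set (a := fun i : Ix => (c i * e (phase i t z1 z2))%CC).
change (Cnorm (a i0) <= K).
destruct (H t z1 z2 ht) as [hB hC].
apply le_epsilon; intros eps heps.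
destruct (Ccv_idx_tail m a hB eps heps) as [N0 H0].
set (N := max (fst i0) N0).
(* Inside [idx m N], two values of x or of y differ by at most [8 N m] and two values of n by at
   most [N]; [B] exceeds both, so the three differences act as digits in base [B]. *)
set (B := (8 * Z.of_nat N * Z.of_nat m + Z.of_nat N + 1)%Z).
(* An integral linear form separating the indices in [idx m N]. *)
set (p := fun i : Ix => (Z.of_nat (fst i) + B * fst (snd i) - B * B * snd (snd i))%Z).
assert (hbd : forall i, In i (idx m N) -> (Z.of_nat (fst i) <= Z.of_nat N)%Z /\
  (Z.abs (fst (snd i)) <= 4 * Z.of_nat N * Z.of_nat m)%Z /\
  (Z.abs (snd (snd i)) <= 4 * Z.of_nat N * Z.of_nat m)%Z).
{ intros [n [x y]] hi; apply in_idx in hi; cbn [fst snd] in *; destruct hi as [h1 h2].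
  apply in_suppList in h2; split; [lia | ].
  assert (4 * Z.of_nat n * Z.of_nat m <= 4 * Z.of_nat N * Z.of_nat m)%Z
    by (apply Z.mul_le_mono_nonneg_r; lia).
  assert (Z.abs x <= x * x /\ Z.abs y <= y * y)%Z by nia; split; lia. }
assert (hi0N : In i0 (idx m N)) by (apply in_idx; split; [lia | auto]).
assert (hsum : CS (fun i => if (p i =? p i0)%Z then a i else C0) (idx m N) = a i0).
{ rewrite (CS_delta _ (idx m N) i0); [rewrite Z.eqb_refl; auto | apply NoDup_idx | auto | ].
intros i hi hne; destruct (Z.eqb_spec (p i) (p i0)) as [E | ]; auto.
    elim hne; destruct (hbd i hi) as (h1 & h2 & h3); destruct (hbd i0 hi0N) as (h4 & h5 & h6).
    unfold p in E; destruct i as [n [x y]], i0 as [n0 [x0 y0]]; cbn [fst snd] in *.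
    set (Nm := (4 * Z.of_nat N * Z.of_nat m)%Z) in *.
    assert (hBe : B = (2 * Nm + Z.of_nat N + 1)%Z) by (unfold B, Nm; ring).
    set (dn := (Z.of_nat n - Z.of_nat n0)%Z); set (dx := (x - x0)%Z); set (dy := (y - y0)%Z).
    assert (hq : (B * dy - dx = 0)%Z).
    { apply (small_multiple dn B); unfold dn, dx, dy; [lia | lia]. }
    assert (hy0 : dy = 0%Z) by (apply (small_multiple dx B); unfold dx in *; lia).
    rewrite hy0 in hq; assert (dx = 0)%Z by lia.
    unfold dx, dy in *; replace x with x0 in * by lia; replace y with y0 in * by lia.
    replace n with n0 by lia; reflexivity. }
rewrite <- hsum; apply average_extract; intros M s hM.
set (x := INR s / INR M).
(* With [r = (x0 + i y0)/2] one has [r w + conj (r w) = x0 Re w - y0 Im w], so this shift produces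
   the [B] and [B * B] parts of [p]. *)
set (w := (IZR B * x, IZR (B * B) * x) : CC).
assert (hph : forall i : Ix, (a i * e (RtoC (IZR (p i) * x)))%CC =
  (c i * e (phase i (t + RtoC x) (z1 + w) (z2 + Cconj w)))%CC).
{ intros i; unfold a, p, phase, w.
  rewrite minus_IZR, plus_IZR, !mult_IZR, <- INR_IZR_INZ.
  set (u := (IZR B * x, IZR B * IZR B * x) : CC).
  set (v := RtoC ((INR (fst i) + IZR B * IZR (fst (snd i)) - IZR B * IZR B * IZR (snd (snd i))) * x)).
  replace (NtoC (fst i) * (t + RtoC x) + ix_r i * (z1 + u) + Cconj (ix_r i) * (z2 + Cconj u))%CC
    with ((NtoC (fst i) * t + ix_r i * z1 + Cconj (ix_r i) * z2) + v)%CC.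
  - set (ph := (NtoC (fst i) * t + ix_r i * z1 + Cconj (ix_r i) * z2)%CC); rewrite e_add; ring.
  - unfold ix_r, u, v; apply CC_ext; cc_unfold; field. }
assert (ht' : inH (t + RtoC x)%CC) by (unfold inH in *; cc_unfold; lra).
destruct (H (t + RtoC x)%CC (z1 + w)%CC (z2 + Cconj w)%CC ht') as [_ hC'].
rewrite (CS_ext _ (fun i => c i * e (phase i (t + RtoC x) (z1 + w) (z2 + Cconj w)))%CC)
  by (intros; apply hph).
set (g' := fun i : Ix => (c i * e (phase i (t + RtoC x) (z1 + w) (z2 + Cconj w)))%CC) in *.
assert (h : Cnorm (f (t + RtoC x) (z1 + w) (z2 + Cconj w) - CS g' (idx m N))%CC <= eps).
{ apply H0; auto; [lia | ].
  intros i; unfold g'; rewrite <- hph, Cnorm_mul, (Cnorm_e (RtoC _)).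
  replace (exp _) with 1; [ring | rewrite <- exp_0; f_equal; cc_unfold; ring]. }
specialize (hK x w); set (F := f _ _ _) in *; set (G := CS g' _) in *.
replace G with (F - (F - G))%CC by ring.
apply Rle_trans with (1 := Cnorm_sub _ _); lra.
Qed.

(** * Vanishing of the low coefficients *)

(* [pol d p]: [p] is a polynomial function of degree < [d]. *)
Fixpoint pol (d : nat) (p : R -> R) : Prop :=
  match d with
  | O => forall s, p s = 0
  | S d' => exists a q, pol d' q /\ forall s, p s = q s + a * s ^ d'
  end.

Lemma pol_ext d p q : (forall s, p s = q s) -> pol d p -> pol d q.
Proof.
destruct d; cbn; intros h H; [intros; rewrite <- h; auto | ].
destruct H as (a & r & hr & hp); exists a, r; split; auto; intros; rewrite <- h; auto.
Qed.

Lemma pol_add d p q : pol d p -> pol d q -> pol d (fun s => p s + q s).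
Proof.
revert p q; induction d as [ | d IH]; cbn; intros p q hp hq; [intros; rewrite hp, hq; ring | ].
destruct hp as (a & r & hr & hp), hq as (b & r' & hr' & hq).
exists (a + b), (fun s => r s + r' s); split; auto; intros; rewrite hp, hq; ring.
Qed.

Lemma pol_scal d a p : pol d p -> pol d (fun s => a * p s).
Proof.
revert p; induction d as [ | d IH]; cbn; intros p hp; [intros; rewrite hp; ring | ].
destruct hp as (b & r & hr & hp); exists (a * b), (fun s => a * r s); split; auto.
intros; rewrite hp; ring.
Qed.

Lemma pol_S d p : pol d p -> pol (S d) p.
Proof. intros h; exists 0, p; split; auto; intros; ring. Qed.

Lemma pol_le d d' p : (d <= d')%nat -> pol d p -> pol d' p.
Proof. induction 1; auto; intros; apply pol_S; auto. Qed.

Lemma pol_mul_X d p : pol d p -> pol (S d) (fun s => s * p s).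
Proof.
revert p; induction d as [ | d IH]; intros p hp.
- exists 0, (fun _ => 0); cbn in *; split; auto; intros; rewrite hp; ring.
- destruct hp as (a & q & hq & hp); exists a, (fun s => s * q s); split; auto.
  intros; rewrite hp; cbn; ring.
Qed.

Lemma pol_prod_roots {A} (u : A -> R) (l : list A) :
  pol (S (length l)) (fun s => fold_right Rmult 1 (map (fun j => s - u j) l)).
Proof.
induction l as [ | j l IH]; cbn [length map fold_right].
- exists 1, (fun _ => 0); cbn; split; auto; intros; ring.
- set (p := fun s => fold_right Rmult 1 (map (fun j => s - u j) l)) in *.
  apply (pol_ext _ (fun s => s * p s + - u j * p s)); [intros; unfold p; ring | ].
  apply pol_add; [apply pol_mul_X; auto | apply pol_S, pol_scal; auto].
Qed.

(** The degree rises only through the second product of the recursion, whose factor is positive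
    since [k + 2 nu >= 1]; the tau-derivative part has degree at most [a + nu] and falls into the
    remainder. *)
Lemma dnu_poly_lead k m n nu a : (0 < k)%nat -> exists A q, A <> 0 /\ pol (a + nu) q /\
  forall s, dnu_poly k m nu a n s = A * s ^ (a + nu) + q s.
Proof.
intros hk; revert a; induction nu as [ | nu IH]; intros a.
- exists (/ INR (fact a * fact a)), (fun _ => 0); rewrite Nat.add_0_r; split; [ | split].
  + apply Rinv_neq_0_compat, not_0_INR; generalize (fact_neq_0 a); nia.
  + apply pol_le with 0%nat; [lia | cbn; auto].
  + intros s; cbn [dnu_poly]; unfold Rdiv; ring.
- destruct (IH a) as (A1 & q1 & hA1 & hq1 & h1); destruct (IH (S a)) as (A2 & q2 & hA2 & hq2 & h2).
  set (K1 := - (16 * PI * PI * INR m * INR n)).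
  set (K2 := (2 * INR (k + 2 * nu) - 2) * INR (S a) + (2 * INR (k + 2 * nu) - 2) * INR (S a)
         + 4 * INR (S a * S a)).
  assert (hK2 : 0 < K2).
  { unfold K2; assert (1 <= INR (k + 2 * nu)) by (apply (le_INR 1); lia).
    assert (0 <= INR (S a)) by apply pos_INR.
    assert (0 < INR (S a * S a)) by (apply lt_0_INR; lia).
    nra. }
  exists (- K2 * A2), (fun s => K1 * dnu_poly k m nu a n s + - K2 * q2 s).
  replace (a + S nu)%nat with (S (a + nu)) by lia.
  replace (S a + nu)%nat with (S (a + nu)) in * by lia.
  split; [ | split].
  + nra.
  + apply pol_add; apply pol_scal; auto.
    exists A1, q1; split; auto; intros; rewrite h1; ring.
  + intros s; cbn [dnu_poly]; fold K1 K2; rewrite (h2 s); ring.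
Qed.

Lemma RtoC_add x y : RtoC (x + y) = (RtoC x + RtoC y)%CC.
Proof. apply CC_ext; cc_unfold; ring. Qed.

Lemma RtoC_mul x y : RtoC (x * y) = (RtoC x * RtoC y)%CC.
Proof. apply CC_ext; cc_unfold; ring. Qed.

Lemma Cmul_integral z w : (z * w)%CC = C0 -> z <> C0 -> w = C0.
Proof.
intros h hz; transitivity (Cinv z * (z * w))%CC.
- transitivity ((Cinv z * z) * w)%CC; [rewrite Cmul_inv_l by auto; ring | ring].
- rewrite h; ring.
Qed.

Lemma RtoC_neq0 x : x <> 0 -> RtoC x <> C0.
Proof. intros h E; injection E; auto. Qed.

(** Triangularity: [P 0], ..., [P (D - 1)] have exact degrees 0, ..., D - 1 and therefore span all
    polynomials of degree below [D]. *)
Lemma pol_killed {A} (L : list A) (d : A -> CC) (u : A -> R) (P : nat -> R -> R) D :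
  (forall nu, exists a q, a <> 0 /\ pol nu q /\ forall s, P nu s = a * s ^ nu + q s) ->
  (forall nu, (nu < D)%nat -> CS (fun i => d i * RtoC (P nu (u i)))%CC L = C0) ->
  forall p, pol D p -> CS (fun i => d i * RtoC (p (u i)))%CC L = C0.
Proof.
intros hlead; induction D as [ | D IH]; intros hP p hp.
- apply CS_zero; intros i _; rewrite hp; apply CC_ext; cc_unfold; ring.
- destruct hp as (b & q & hq & hp).
  assert (IH' := IH (fun nu h => hP nu (Nat.lt_lt_succ_r _ _ h))).
  destruct (hlead D) as (a & r & ha & hr & hPD).
  specialize (hP D (Nat.lt_succ_diag_r D)).
  assert (hX : CS (fun i => d i * RtoC (u i ^ D))%CC L = C0).
  { apply (Cmul_integral (RtoC a)); [ | apply RtoC_neq0; auto].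
    rewrite <- hP, <- CS_scal.
    transitivity (CS (fun i => RtoC a * (d i * RtoC (u i ^ D)))%CC L +
                  CS (fun i => d i * RtoC (r (u i)))%CC L)%CC;
      [rewrite (IH' r hr); ring | ].
    rewrite <- CS_add; apply CS_ext; intros i _; rewrite hPD, RtoC_add, RtoC_mul; ring. }
  transitivity (CS (fun i => d i * RtoC (q (u i)))%CC L +
    RtoC b * CS (fun i => d i * RtoC (u i ^ D))%CC L)%CC; [ | rewrite hX, (IH' q hq); ring].
  rewrite <- CS_scal, <- CS_add; apply CS_ext; intros i _.
  rewrite hp, RtoC_add, RtoC_mul; ring.
Qed.

Lemma prod_roots_eq0 {A} (u : A -> R) (l : list A) s :
  fold_right Rmult 1 (map (fun j => s - u j) l) = 0 <-> exists j, In j l /\ u j = s.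
Proof.
induction l as [ | a l IH]; cbn.
- split; [lra | intros (j & [] & _)].
- split.
  + intros h; apply Rmult_integral in h; destruct h as [h | h].
    * exists a; split; auto; lra.
    * apply IH in h; destruct h as (j & h1 & h2); exists j; auto.
  + intros (j & [-> | hj] & h); [rewrite h; ring | ].
    rewrite (proj2 IH); [ring | exists j; auto].
Qed.

(** Test against the polynomial [p] whose roots are the values [u j] outside the class of [i0];
    repeated roots are harmless, and the degree is at most the length of [L]. Only the class
    survives, where [d] is constant, so the sum is the class size times [p (u i0)] times [d i0], and
    the first two factors are nonzero. *)
Lemma killed_class_zero {A} (L : list A) (d : A -> CC) (u : A -> R) (P : nat -> R -> R) (i0 : A) :
  (forall nu, exists a q, a <> 0 /\ pol nu q /\ forall s, P nu s = a * s ^ nu + q s) ->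
  (forall nu, (nu <= length L)%nat -> CS (fun i => d i * RtoC (P nu (u i)))%CC L = C0) ->
  (forall i, In i L -> u i = u i0 -> d i = d i0) -> In i0 L -> d i0 = C0.
Proof.
intros hlead hP hd hi0.
set (eqb := fun i => if Req_dec_T (u i) (u i0) then true else false).
set (l := filter (fun i => negb (eqb i)) L).
set (p := fun s => fold_right Rmult 1 (map (fun j => s - u j) l)).
assert (hl : (length l <= length L)%nat) by apply filter_length_le.
assert (h : CS (fun i => d i * RtoC (p (u i)))%CC L = C0).
{ apply (pol_killed L d u P (S (length l)) hlead); [ | apply pol_prod_roots].
  intros nu hnu; apply hP; lia. }
rewrite (CS_ext _ (fun i => if eqb i then (d i0 * RtoC (p (u i0)))%CC else C0)) in h.
2:{ intros i hi; unfold eqb; destruct (Req_dec_T (u i) (u i0)) as [E | E].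
  - rewrite (hd i hi E), E; reflexivity.
  - replace (p (u i)) with 0; [apply CC_ext; cc_unfold; ring | symmetry].
    apply prod_roots_eq0; exists i; split; auto; apply filter_In; split; auto.
    unfold eqb; destruct (Req_dec_T (u i) (u i0)); auto. }
rewrite <- CS_filter, CS_const in h; unfold NtoC in h.
apply Cmul_integral in h.
- replace (d i0 * RtoC (p (u i0)))%CC with (RtoC (p (u i0)) * d i0)%CC in h by ring.
  apply Cmul_integral in h; auto; apply RtoC_neq0; intros E.
  apply prod_roots_eq0 in E; destruct E as (j & hj & E); apply filter_In in hj.
  destruct hj as [_ hj]; unfold eqb in hj; destruct (Req_dec_T (u j) (u i0)); [discriminate | auto].
- apply RtoC_neq0, not_0_INR; intros E; apply length_zero_iff_nil in E.
  assert (hin : In i0 (filter eqb L)).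
  { apply filter_In; split; auto; unfold eqb; destruct (Req_dec_T (u i0) (u i0)); auto. }
  rewrite E in hin; destruct hin.
Qed.

(** * Counting indices, and the size of [kappa] *)

Lemma length_suppList_le m n : (length (suppList m n) <=
  fold_right Nat.add 0 (map (fun d => rcount (Z.of_nat d))
    (seq 0 (S (Z.to_nat (4 * Z.of_nat m * Z.of_nat n))))))%nat.
Proof.
set (N := Z.to_nat (4 * Z.of_nat m * Z.of_nat n)).
change (fold_right Nat.add 0%nat) with list_sum; unfold rcount.
rewrite <- (length_flat_map (fun d => filter (fun p : Z * Z =>
  (fst p * fst p + snd p * snd p =? Z.of_nat d)%Z)
  (list_prod (zrange (Z.of_nat d)) (zrange (Z.of_nat d))))).
apply NoDup_incl_length; [apply NoDup_suppList | ].
intros [x y] h; apply in_suppList in h; apply in_flat_map.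
exists (Z.to_nat (x * x + y * y)); split.
- apply in_seq; unfold N; nia.
- rewrite Z2Nat.id by nia; apply filter_In; cbn [fst snd]; split; [ | apply Z.eqb_refl].
  apply in_prod_iff; rewrite !in_zrange; nia.
Qed.

Lemma in_le_list_sum (l : list nat) a : In a l -> (a <= fold_right Nat.add 0 l)%nat.
Proof. induction l as [ | b l IH]; cbn; [tauto | intros [-> | h]; [lia | specialize (IH h); lia]]. Qed.

(** [Rzero] adds up the counts for all n from 0 to [kappa]; the single summand at [n] already bounds
    the number of r in the block. *)
Lemma length_suppList_Rzero k m n : (0 < m)%nat -> (Z.of_nat n <= kappa k m)%Z ->
  (length (suppList m n) <= Rzero k m)%nat.
Proof.
intros hm hn; apply Nat.le_trans with (1 := length_suppList_le m n).
unfold Rzero, Rfun; apply in_le_list_sum, in_map_iff; exists n; split; auto.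
apply in_seq; rewrite Z.mul_comm, Z.div_mul by lia; lia.
Qed.

(** For fixed n, equality of [sig] means equality of N(r), hence of the discriminant, so the last
    hypothesis is the trace of the Spezialschar condition on one block. The nodes [sig i] number at
    most [Rzero], enough for the interpolation. *)
Lemma block_coeffs_zero k m n (d : Ix -> CC) : (0 < k)%nat -> (0 < m)%nat ->
  (Z.of_nat n <= kappa k m)%Z ->
  (forall nu, (nu <= Rzero k m)%nat ->
    CS (fun i => d i * RtoC (dnu_poly k m nu 0 (fst i) (sig i)))%CC (map (pair n) (suppList m n)) = C0) ->
  (forall i j, fst i = n -> fst j = n -> In (snd i) (suppList m n) -> In (snd j) (suppList m n) ->
     sig i = sig j -> d i = d j) ->
  forall i, fst i = n -> In (snd i) (suppList m n) -> d i = C0.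
Proof.
intros hk hm hn hkill hd i0 h1 h2.
apply (killed_class_zero (map (pair n) (suppList m n)) d sig (fun nu => dnu_poly k m nu 0 n)).
- intros nu; exact (dnu_poly_lead k m n nu 0 hk).
- intros nu hnu; rewrite length_map in hnu.
  rewrite <- (hkill nu) by (generalize (length_suppList_Rzero k m n hm hn); lia).
  apply CS_ext; intros i hi; apply in_block in hi; rewrite (proj1 hi); reflexivity.
- intros i hi; apply in_block in hi; apply hd; tauto.
- apply in_block; auto.
Qed.

Lemma sig_inj i j : sig i = sig j ->
  (fst (snd i) * fst (snd i) + snd (snd i) * snd (snd i) =
   fst (snd j) * fst (snd j) + snd (snd j) * snd (snd j))%Z.
Proof.
unfold sig; intros h; apply eq_IZR; rewrite !plus_IZR, !mult_IZR.
assert (hP := PI_RGT_0); apply Rmult_eq_reg_l in h; auto; nra.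
Qed.

(* Telescoping: [prod_{p >= a} (1 - p^-2) = (a - 1) / a] over all integers [p >= a]. *)
Lemma euler_product_bound (f : Z -> bool) b : forall a, (2 <= a)%nat ->
  let ps := filter f (map Z.of_nat (seq a b)) in
  let P1 := fold_right Z.mul 1%Z (map (fun p => p * p - 1)%Z ps) in
  let P2 := fold_right Z.mul 1%Z (map (fun p => p * p)%Z ps) in
  ((Z.of_nat a - 1) * P2 <= Z.of_nat a * P1 /\ 0 < P2)%Z.
Proof.
induction b as [ | b IH]; intros a ha; [cbn; lia | ].
specialize (IH (S a) ltac:(lia)); cbn [seq map filter].
set (ps := filter f (map Z.of_nat (seq (S a) b))) in *.
cbv zeta in *.
set (P1 := fold_right Z.mul 1%Z (map (fun p => p * p - 1)%Z ps)) in *.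
set (P2 := fold_right Z.mul 1%Z (map (fun p => p * p)%Z ps)) in *.
replace (Z.of_nat (S a)) with (Z.of_nat a + 1)%Z in IH by lia.
destruct IH as [IH hP2]; set (x := Z.of_nat a) in *.
assert (hx : (2 <= x)%Z) by lia.
assert (IH' : (x * P2 <= (x + 1) * P1)%Z) by lia.
destruct (f x); cbn [map fold_right]; fold P1 P2; split; try nia.
assert (((x - 1) * (x * x * P2)) <= x * ((x - 1) * ((x + 1) * P1)))%Z; [ | lia].
replace ((x - 1) * (x * x * P2))%Z with (x * ((x - 1) * (x * P2)))%Z by ring.
apply Z.mul_le_mono_nonneg_l; [lia | apply Z.mul_le_mono_nonneg_l; lia].
Qed.

(** Telescoping from 2 gives [P2 <= 2 P1], which turns the factor 8 in [kappa] into 4; the [+ 1]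
    accounts for the integer part. *)
Lemma kappa_bounds k m : (0 < k)%nat -> (0 < m)%nat -> (0 <= kappa k m)%Z /\
  (4 * Z.of_nat m * Z.of_nat m * (Z.of_nat k - 1) + 3 * Z.of_nat m < 6 * (kappa k m + 1))%Z.
Proof.
intros hk hm; unfold kappa, primesDividing; cbv zeta.
assert (h := euler_product_bound (fun p => isPrimeb p && ((4 * Z.of_nat m) mod p =? 0)%Z)
  (Z.to_nat (4 * Z.of_nat m)) 2 (le_n 2)); cbv zeta in h.
set (ps := filter _ _) in *.
set (P1 := fold_right Z.mul 1%Z (map (fun p => p * p - 1)%Z ps)) in *.
set (P2 := fold_right Z.mul 1%Z (map (fun p => p * p)%Z ps)) in *.
destruct h as [h hP2]; cbn [Z.of_nat Pos.of_succ_nat Pos.succ] in h.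
set (a := (8 * Z.of_nat m * Z.of_nat m * (Z.of_nat k - 1) * P1 + 3 * Z.of_nat m * P2)%Z).
set (Q := (4 * Z.of_nat m * Z.of_nat m * (Z.of_nat k - 1))%Z).
assert (hQ : (0 <= Q)%Z) by (unfold Q; nia).
assert (ha : ((Q + 3 * Z.of_nat m) * P2 <= a)%Z).
{ replace a with (Q * (2 * P1) + 3 * Z.of_nat m * P2)%Z by (unfold a, Q; ring).
  rewrite Z.mul_add_distr_r; apply Z.add_le_mono_r, Z.mul_le_mono_nonneg_l; lia. }
split; [apply Z.div_pos; nia | ].
assert (h1 := Z.mul_succ_div_gt a (6 * P2) ltac:(lia)).
set (q := (a / (6 * P2))%Z) in *.
nia.
Qed.

Lemma reduce_mod_centered m x : (0 < m)%Z -> exists a, (Z.abs (x + 2 * m * a) <= m)%Z.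
Proof.
intros hm; exists (- ((x + m) / (2 * m)))%Z.
generalize (Z.div_mod (x + m) (2 * m) ltac:(lia)) (Z.mod_pos_bound (x + m) (2 * m) ltac:(lia)).
intros; lia.
Qed.

(* Translating [r] by [m O_K] brings [r] into a square without changing [4 m n - 4 N(r)],
   so the lowest discriminant is bounded below by the lowest [n]. *)
Lemma low_discriminant_zero m (d : Ix -> CC) K : (0 < m)%nat ->
  (forall i j, In (snd i) (suppList m (fst i)) -> In (snd j) (suppList m (fst j)) ->
    (4 * Z.of_nat (fst i) * Z.of_nat m - (fst (snd i) * fst (snd i) + snd (snd i) * snd (snd i)) =
     4 * Z.of_nat (fst j) * Z.of_nat m - (fst (snd j) * fst (snd j) + snd (snd j) * snd (snd j)))%Z ->
    d i = d j) ->
  (forall i, (Z.of_nat (fst i) <= K)%Z -> In (snd i) (suppList m (fst i)) -> d i = C0) ->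
  forall i, In (snd i) (suppList m (fst i)) -> d i <> C0 ->
  (4 * Z.of_nat m * (K + 1) - 2 * Z.of_nat m * Z.of_nat m <=
   4 * Z.of_nat (fst i) * Z.of_nat m - (fst (snd i) * fst (snd i) + snd (snd i) * snd (snd i)))%Z.
Proof.
intros hm hd hz [n [x y]] hi hne; cbn [fst snd] in *.
destruct (reduce_mod_centered (Z.of_nat m) x) as [a ha]; [lia | ].
destruct (reduce_mod_centered (Z.of_nat m) y) as [b hb]; [lia | ].
set (x' := (x + 2 * Z.of_nat m * a)%Z) in *; set (y' := (y + 2 * Z.of_nat m * b)%Z) in *.
(* The step from r to [r + m (a + i b)] increases N(r)/m by the integer [a x + b y + m (a^2 + b^2)];
   [n'] makes up for it. *)
set (n' := (Z.of_nat n + (a * x + Z.of_nat m * (a * a)) + (b * y + Z.of_nat m * (b * b)))%Z).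
apply in_suppList in hi.
assert (E : (4 * n' * Z.of_nat m - (x' * x' + y' * y') =
  4 * Z.of_nat n * Z.of_nat m - (x * x + y * y))%Z) by (unfold n', x', y'; ring).
assert (hn' : (0 <= n')%Z).
{ assert (0 <= x' * x')%Z by apply Z.square_nonneg; assert (0 <= y' * y')%Z by apply Z.square_nonneg.
  clearbody n' x' y'; nia. }
assert (hi' : In (x', y') (suppList m (Z.to_nat n'))).
{ apply in_suppList; rewrite Z2Nat.id by auto; lia. }
assert (Ed : d (n, (x, y)) = d (Z.to_nat n', (x', y'))).
{ apply hd; cbn [fst snd]; auto; [apply in_suppList; auto | rewrite Z2Nat.id by auto; lia]. }
assert (hK : (K < n')%Z).
{ apply Z.nle_gt; intros hle; apply hne; rewrite Ed; apply hz; cbn [fst snd]; auto.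
  rewrite Z2Nat.id; auto. }
assert (hx2 : (x' * x' <= Z.of_nat m * Z.of_nat m)%Z) by (apply Z.abs_le in ha; nia).
assert (hy2 : (y' * y' <= Z.of_nat m * Z.of_nat m)%Z) by (apply Z.abs_le in hb; nia).
rewrite <- E; clearbody n' x' y'; nia.
Qed.

(** * The invariant norm *)

Definition Nrm2 (z : CC) : R := Cre z * Cre z + Cim z * Cim z.

(** [k2] is half the weight, so that [|j|^k] becomes a power of [Nrm2 j]. In the coordinates
    [(l, u)] the lattice acts by translations and the modular group linearly. *)
Definition petersson (m k2 : nat) (f : CC -> CC -> CC -> CC) (t l u : CC) : R :=
  Cnorm (f t (l * t + u)%CC (Cconj l * t + Cconj u)%CC) * Cim t ^ k2 *
  exp (- (2 * PI * INR m * (Nrm2 l * Cim t))).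

(** Since [z1 = l j + n], one gets [z1 / j = (-n)(-1/j) + l]: the inversion exchanges the two
    coordinates up to sign. The factor [|j|^(-2 k2)] is absorbed by the new height, and the
    exponential factor turns the Gaussian in [l] into the one in [n]. *)
Lemma petersson_inversion m k2 f (b : Z) :
  (forall t z1 z2, inH t -> slashM (2 * k2) m C1 0 (-1) 1 (- b) f t z1 z2 = f t z1 z2) ->
  forall t l u, inH t ->
  let j := (t - RtoC (IZR b))%CC in let n := (u + l * RtoC (IZR b))%CC in
  Cim (Copp (Cinv j)) = Cim t / Nrm2 j /\
  petersson m k2 f t l u = petersson m k2 f (Copp (Cinv j)) (Copp n) l.
Proof.
intros H t l u ht j n.
assert (hN : 0 < Nrm2 j).
{ replace (Nrm2 j) with ((Cre t - IZR b) * (Cre t - IZR b) + Cim t * Cim t)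
    by (unfold j, Nrm2; cc_unfold; ring).
  apply Rplus_le_lt_0_compat; [apply Rle_0_sqr | apply Rmult_lt_0_compat; auto]. }
assert (hj : j <> C0).
{ intros E; rewrite E in hN; unfold Nrm2, C0 in hN; cbn in hN; lra. }
assert (hjn : Cnorm j * Cnorm j = Nrm2 j) by apply Cnorm_sqr.
assert (him : Cim (Copp (Cinv j)) = Cim t / Nrm2 j).
{ unfold j, Nrm2 in *; cc_unfold; field; lra. }
split; auto.
unfold petersson; rewrite him.
set (z1 := (l * t + u)%CC); set (z2 := (Cconj l * t + Cconj u)%CC).
rewrite <- (H t z1 z2 ht) at 1; unfold slashM; cbv zeta.
replace (ZtoC 1 * t + ZtoC (- b))%CC with j
  by (unfold j, ZtoC; rewrite opp_IZR; apply CC_ext; cc_unfold; ring).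
replace ((ZtoC 0 * t + ZtoC (-1)) / j)%CC with (Copp (Cinv j))
  by (unfold Cdiv, ZtoC; set (w := Cinv j); apply CC_ext; cc_unfold; ring).
replace (C1 * z1 / j)%CC with (Copp n * Copp (Cinv j) + l)%CC.
2:{ transitivity ((n + l * j) / j)%CC; [field; auto | ].
    replace (n + l * j)%CC with (C1 * z1)%CC; auto.
    unfold n, j, z1; ring. }
replace (Cconj C1 * z2 / j)%CC with (Cconj (Copp n) * Copp (Cinv j) + Cconj l)%CC.
2:{ transitivity ((Cconj n + Cconj l * j) / j)%CC.
    - replace (Cconj (Copp n)) with (Copp (Cconj n)) by (apply CC_ext; cc_unfold; ring).
      field; auto.
    - replace (Cconj n + Cconj l * j)%CC with (Cconj C1 * z2)%CC; auto.
      unfold n, j, z2; apply CC_ext; cc_unfold; ring. }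
rewrite !Cnorm_mul, Cnorm_e, !Cnorm_inv, !Cnorm_pow, Cnorm_C1, pow1, Rinv_1.
2:{ intros E; apply (f_equal Cnorm) in E; rewrite Cnorm_pow, Cnorm_C0 in E.
    apply pow_nonzero in E; auto; intros E'; apply hj, Cnorm_eq0; auto. }
2:{ intros E; apply (f_equal Cnorm) in E; rewrite Cnorm_pow, Cnorm_C0, Cnorm_C1, pow1 in E; lra. }
rewrite pow_mult; cbn [pow]; rewrite Rmult_1_r, hjn.
set (F := Cnorm (f _ _ _)).
(* With [z2 = conj(l) j + conj(n)] the mixed terms of [z1 z2 / j] are real, which leaves [Im (z1 z2
   / j) = |l|^2 Im t - |n|^2 Im t / |j|^2]. *)
replace (exp (- (2 * PI * Cim (Copp (NtoC m * ZtoC 1 * z1 * z2 / j)%CC)))) with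
  (exp (2 * PI * INR m * (Nrm2 l * Cim t)) * exp (- (2 * PI * INR m * (Nrm2 (Copp n) * (Cim t / Nrm2 j))))).
2:{ rewrite <- exp_plus; f_equal.
    transitivity (2 * PI * INR m * (Nrm2 l * Cim t - Nrm2 (Copp n) * (Cim t / Nrm2 j))); [ring | ].
    transitivity (2 * PI * INR m * Cim (z1 * z2 / j)%CC).
    - f_equal; unfold Nrm2, z1, z2, n, j in *; cc_unfold; field; lra.
    - set (w := (z1 * z2 / j)%CC).
      replace (NtoC m * ZtoC 1 * z1 * z2 / j)%CC with (NtoC m * ZtoC 1 * w)%CC
        by (unfold w; field; auto).
      cc_unfold; ring. }
unfold Rdiv; rewrite Rpow_mult_distr, pow_inv.
rewrite (exp_Ropp (2 * PI * INR m * (Nrm2 l * Cim t))).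
assert (hE := exp_pos (2 * PI * INR m * (Nrm2 l * Cim t))).
set (E := exp (2 * PI * INR m * (Nrm2 l * Cim t))) in *.
set (E' := exp (- _)); field; repeat split; first [lra | apply pow_nonzero; lra].
Qed.

Lemma petersson_translate m k2 f (a b : Z) :
  (forall t z1 z2, inH t -> slashH m (gauss a b) (gauss 0 0) f t z1 z2 = f t z1 z2) ->
  forall t l u, inH t -> petersson m k2 f t (l + gauss a b)%CC u = petersson m k2 f t l u.
Proof.
intros H t l u ht; unfold petersson.
set (z1 := (l * t + u)%CC); set (z2 := (Cconj l * t + Cconj u)%CC).
rewrite <- (H t z1 z2 ht); unfold slashH.
replace (z1 + gauss a b * t + gauss 0 0)%CC with ((l + gauss a b) * t + u)%CC
  by (unfold z1; apply CC_ext; cc_unfold; ring).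
replace (z2 + Cconj (gauss a b) * t + Cconj (gauss 0 0))%CC
  with (Cconj (l + gauss a b) * t + Cconj u)%CC
  by (unfold z2; apply CC_ext; cc_unfold; ring).
rewrite Cnorm_mul, Cnorm_e; set (F := Cnorm (f _ _ _)).
replace (exp (- (2 * PI * INR m * (Nrm2 (l + gauss a b)%CC * Cim t)))) with
  (exp (- (2 * PI * Cim (NtoC m * (gauss a b * Cconj (gauss a b) * t + Cconj (gauss a b) * z1 +
     gauss a b * z2))%CC)) * exp (- (2 * PI * INR m * (Nrm2 l * Cim t)))); [ring | ].
rewrite <- exp_plus; f_equal; unfold Nrm2, z1, z2; cc_unfold; ring.
Qed.

Lemma nearest_int x : exists b : Z, Rabs (x - IZR b) <= / 2.
Proof.
exists (Int_part (x + / 2)); destruct (base_Int_part (x + / 2)) as [h1 h2].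
apply Rabs_le; lra.
Qed.

(** For [|Re j| <= 1/2] an inversion takes height v to at least [v / (1/4 + v^2)]. This is at least
    17/20 on the whole interval from 3/10 to 17/20, because [(17/20)(v^2 + 1/4) - v] is convex and
    negative at both ends. *)
Lemma petersson_descend m k2 f S :
  (forall b t z1 z2, inH t -> slashM (2 * k2) m C1 0 (-1) 1 b f t z1 z2 = f t z1 z2) ->
  (forall t l u, 17 / 20 <= Cim t -> petersson m k2 f t l u <= S) ->
  forall t l u, 3 / 10 <= Cim t -> petersson m k2 f t l u <= S.
Proof.
intros H HS t l u ht.
destruct (Rle_lt_dec (17 / 20) (Cim t)) as [h | h]; auto.
destruct (nearest_int (Cre t)) as [b hb].
destruct (petersson_inversion m k2 f b (H (- b)%Z) t l u) as [him ->]; [unfold inH; lra | ].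
apply HS; rewrite him.
set (j := (t - RtoC (IZR b))%CC).
assert (hj : Nrm2 j = (Cre t - IZR b) * (Cre t - IZR b) + Cim t * Cim t).
{ unfold j, Nrm2; cc_unfold; ring. }
set (a := Cre t - IZR b) in *; clearbody a.
assert (hsq : a * a <= / 4).
{ assert (h1 := Rabs_pos a).
  assert (h2 : Rabs a * Rabs a = a * a) by (rewrite <- Rabs_mult; apply Rabs_right; nra).
  nra. }
assert (hpos : 0 < Nrm2 j) by (rewrite hj; nra).
set (v := Cim t) in *; clearbody v.
apply Rmult_le_reg_r with (Nrm2 j); auto.
unfold Rdiv at 2; rewrite Rmult_assoc, Rinv_l, Rmult_1_r by lra.
rewrite hj; nra.
Qed.

(* After completing the square in [r], the exponent of the term of index [(n, r)] is the
   discriminant [disc] plus a Gaussian in [r + m conj(l)]. *)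
Definition disc (m : nat) (i : Ix) : R :=
  INR (fst i) - (IZR (fst (snd i)) * IZR (fst (snd i)) + IZR (snd (snd i)) * IZR (snd (snd i)))
    / (4 * INR m).

Definition lin (i : Ix) (l : CC) : R :=
  INR (fst i) + IZR (fst (snd i)) * Cre l - IZR (snd (snd i)) * Cim l.

Definition expo (m : nat) (i : Ix) (l : CC) : R := lin i l + INR m * Nrm2 l.

Lemma expo_disc m i l : (0 < m)%nat -> expo m i l = disc m i +
  ((IZR (fst (snd i)) + 2 * INR m * Cre l) * (IZR (fst (snd i)) + 2 * INR m * Cre l) +
   (IZR (snd (snd i)) - 2 * INR m * Cim l) * (IZR (snd (snd i)) - 2 * INR m * Cim l)) / (4 * INR m).
Proof.
intros hm; assert (0 < INR m) by (apply lt_0_INR; auto).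
unfold expo, lin, disc, Nrm2; field; lra.
Qed.

Lemma disc_le_expo m i l : (0 < m)%nat -> disc m i <= expo m i l.
Proof.
intros hm; rewrite expo_disc by auto.
assert (0 < INR m) by (apply lt_0_INR; auto).
set (a := IZR (fst (snd i)) + _); set (b := IZR (snd (snd i)) - _).
assert (0 <= (a * a + b * b) / (4 * INR m)); [ | lra].
apply Rmult_le_pos; [nra | left; apply Rinv_0_lt_compat; lra].
Qed.

Lemma Cnorm_term (c : Ix -> CC) i t l u :
  Cnorm (c i * e (phase i t (l * t + u) (Cconj l * t + Cconj u)))%CC =
  Cnorm (c i) * exp (- (2 * PI * (lin i l * Cim t))).
Proof.
rewrite Cnorm_mul, Cnorm_e; do 4 f_equal.
unfold phase, lin, ix_r; cc_unfold; field.
Qed.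

Lemma petersson_le_series m k2 c f B : jseries m c f -> forall t l u, inH t ->
  (forall N, RS (fun i => Cnorm (c i) * exp (- (2 * PI * Cim t * expo m i l))) (idx m N) <= B) ->
  petersson m k2 f t l u <= Cim t ^ k2 * B.
Proof.
intros H t l u ht HB; unfold petersson.
set (z1 := (l * t + u)%CC); set (z2 := (Cconj l * t + Cconj u)%CC).
destruct (H t z1 z2 ht) as [_ hC].
set (E := exp (- (2 * PI * INR m * (Nrm2 l * Cim t)))).
assert (hE : 0 < E) by apply exp_pos.
assert (h : Cnorm (f t z1 z2) <= B / E).
{ apply (Ccv_le _ _ _ hC); intros N; apply Rle_trans with (1 := Cnorm_CS _ _).
  apply Rmult_le_reg_r with E; auto.
  unfold Rdiv; rewrite Rmult_assoc, Rinv_l, Rmult_1_r by lra.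
  apply Rle_trans with (2 := HB N); rewrite Rmult_comm, <- RS_scal.
  right; apply RS_ext; intros i _; unfold z1, z2; rewrite Cnorm_term.
  replace (exp (- (2 * PI * Cim t * expo m i l))) with
    (E * exp (- (2 * PI * (lin i l * Cim t)))); [ring | ].
  unfold E; rewrite <- exp_plus; f_equal; unfold expo; ring. }
assert (0 < Cim t ^ k2) by (apply pow_lt; auto).
apply Rle_trans with (B / E * Cim t ^ k2 * E).
- apply Rmult_le_compat_r; [lra | apply Rmult_le_compat_r; lra].
- right; field; lra.
Qed.

(** Reduces uniformity in [l] over a unit square to its four corners, at each of which absolute
    convergence is available. *)
Lemma exp_mul_le_corners a l : Rabs l <= / 2 -> exp (a * l) <= exp (a * / 2) + exp (a * - / 2).
Proof.
intros hl; assert (h1 := Rle_abs l); assert (h2 := Rle_abs (- l)); rewrite Rabs_Ropp in h2.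
assert (h3 := exp_pos (a * / 2)); assert (h4 := exp_pos (a * - / 2)).
destruct (Rle_lt_dec 0 a).
- assert (exp (a * l) <= exp (a * / 2)) by (apply exp_le_compat; nra); lra.
- assert (exp (a * l) <= exp (a * - / 2)) by (apply exp_le_compat; nra); lra.
Qed.

Lemma two_PI_gt_6 : 6 < 2 * PI.
Proof. generalize PI2_3_2; unfold PI2; lra. Qed.

Lemma exp_INR_mul n x : exp (INR n * x) = exp x ^ n.
Proof.
induction n as [ | n IH]; [cbn; rewrite Rmult_0_l; apply exp_0 | ].
rewrite S_INR; cbn [pow]; rewrite <- IH, <- exp_plus; f_equal; ring.
Qed.

(** Translations bring [l] into the square [|Re l|, |Im l| <= 1/2], where the four corner series at
    height 17/20 are a common majorant. Higher up, a term with nonzero coefficient has exponent at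
    least [k2], and its decay outweighs the growth of [v^k2]. *)
Lemma petersson_bounded m k2 c f : (0 < m)%nat -> jseries m c f ->
  (forall a b t z1 z2, inH t -> slashH m (gauss a b) (gauss 0 0) f t z1 z2 = f t z1 z2) ->
  (forall i, In (snd i) (suppList m (fst i)) -> c i <> C0 -> INR k2 <= disc m i) ->
  exists S, forall t l u, 17 / 20 <= Cim t -> petersson m k2 f t l u <= S.
Proof.
intros hm H Htr hlow; assert (hP := two_PI_gt_6).
assert (Hc : forall s1 s2, Bdd m (fun i => Cnorm (c i) *
  exp (- (2 * PI * (lin i (s1, s2) * (17 / 20)))))).
{ intros s1 s2; set (t := (0, 17 / 20) : CC).
  destruct (H t ((s1, s2) * t + C0)%CC (Cconj (s1, s2) * t + Cconj C0)%CC) as [h _].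
  { unfold inH, t; cbn; lra. }
  revert h; apply Bdd_ext; intros i; rewrite Cnorm_term; reflexivity. }
destruct (Bdd_add _ _ _ (Bdd_add _ _ _ (Hc (/ 2) (/ 2)) (Hc (/ 2) (- / 2)))
  (Bdd_add _ _ _ (Hc (- / 2) (/ 2)) (Hc (- / 2) (- / 2)))) as [B HB].
set (g := fun i => _) in HB.
assert (hg : forall i, 0 <= g i).
{ intros i; unfold g; repeat apply Rplus_le_le_0_compat; apply Rmult_le_pos;
    try apply Cnorm_ge0; left; apply exp_pos. }
assert (hB0 : 0 <= B) by (apply Rle_trans with (2 := HB 0%nat), RS_ge0; auto).
(* The first factor is the [k2]-th power of a bound for [v exp(-2 pi (v - 17/20))], which follows
   from [v <= exp v]. *)
exists (exp (2 * PI * (17 / 20)) ^ k2 * B).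
assert (Hmain : forall t l u, 17 / 20 <= Cim t -> Rabs (Cre l) <= / 2 -> Rabs (Cim l) <= / 2 ->
  petersson m k2 f t l u <= exp (2 * PI * (17 / 20)) ^ k2 * B).
{ intros t l u ht h1 h2; set (v := Cim t) in *.
  assert (hv : inH t) by (unfold inH; fold v; lra).
  apply Rle_trans with (v ^ k2 * (exp (- (2 * PI * (v - 17 / 20) * INR k2)) * B)).
  - apply (petersson_le_series m k2 c); auto; fold v; intros N.
    apply Rle_trans with (exp (- (2 * PI * (v - 17 / 20) * INR k2)) * RS g (idx m N)).
    2:{ apply Rmult_le_compat_l; [left; apply exp_pos | auto]. }
    rewrite <- RS_scal; apply RS_le; intros i hi; apply in_idx in hi.
    assert (hd := fun hne => hlow i (proj2 hi) hne).
    assert (hq : exp (- (2 * PI * (17 / 20) * lin i l)) * Cnorm (c i) <= g i).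
    { set (n := INR (fst i)); set (x := IZR (fst (snd i))); set (y := IZR (snd (snd i))).
      assert (e1 := exp_mul_le_corners (- (2 * PI * (17 / 20) * x)) (Cre l) h1).
      assert (e2 := exp_mul_le_corners (2 * PI * (17 / 20) * y) (Cim l) h2).
      replace (exp (- (2 * PI * (17 / 20) * lin i l))) with
        (exp (- (2 * PI * (17 / 20) * n)) * (exp (- (2 * PI * (17 / 20) * x) * Cre l) *
          exp (2 * PI * (17 / 20) * y * Cim l))).
      2:{ rewrite <- !exp_plus; f_equal; unfold lin; fold n x y; ring. }
      apply Rle_trans with (exp (- (2 * PI * (17 / 20) * n)) *
        ((exp (- (2 * PI * (17 / 20) * x) * / 2) + exp (- (2 * PI * (17 / 20) * x) * - / 2)) *
         (exp (2 * PI * (17 / 20) * y * / 2) + exp (2 * PI * (17 / 20) * y * - / 2))) * Cnorm (c i)).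
      - apply Rmult_le_compat_r; [apply Cnorm_ge0 | ].
        apply Rmult_le_compat_l; [left; apply exp_pos | ].
        apply Rmult_le_compat; auto; left; apply exp_pos.
      - right; unfold g, lin; cbn [Cre Cim fst snd]; fold n x y.
        assert (E : forall s1 s2, exp (- (2 * PI * ((n + x * s1 - y * s2) * (17 / 20)))) =
          exp (- (2 * PI * (17 / 20) * n)) * (exp (- (2 * PI * (17 / 20) * x) * s1) *
          exp (2 * PI * (17 / 20) * y * s2))).
        { intros; rewrite <- !exp_plus; f_equal; ring. }
        rewrite !E; ring. }
    destruct (Req_dec (Cnorm (c i)) 0) as [E0 | E0].
    { rewrite E0, Rmult_0_l; apply Rmult_le_pos; [left; apply exp_pos | auto]. }
    assert (hd' : INR k2 <= disc m i).
    { apply hd; intros E; apply E0; rewrite E; apply Cnorm_C0. }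
    assert (hd2 := disc_le_expo m i l hm).
    apply Rle_trans with (exp (- (2 * PI * (v - 17 / 20) * INR k2)) *
      (exp (- (2 * PI * (17 / 20) * lin i l)) * Cnorm (c i))).
    2:{ apply Rmult_le_compat_l; [left; apply exp_pos | auto]. }
    rewrite <- Rmult_assoc, <- exp_plus, (Rmult_comm (Cnorm (c i))).
    apply Rmult_le_compat_r; [apply Cnorm_ge0 | apply exp_le_compat].
    assert (hn : 0 <= INR m * Nrm2 l).
    { apply Rmult_le_pos; [apply pos_INR | unfold Nrm2; nra]. }
    assert (2 * PI * (v - 17 / 20) * INR k2 <= 2 * PI * (v - 17 / 20) * expo m i l).
    { apply Rmult_le_compat_l; [apply Rmult_le_pos; lra | lra]. }
    assert (2 * PI * (17 / 20) * lin i l <= 2 * PI * (17 / 20) * expo m i l).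
    { apply Rmult_le_compat_l; [lra | unfold expo; lra]. }
    replace (2 * PI * v * expo m i l) with (2 * PI * (v - 17 / 20) * expo m i l +
      2 * PI * (17 / 20) * expo m i l) by ring; lra.
  - rewrite <- Rmult_assoc; apply Rmult_le_compat_r; auto.
    replace (- (2 * PI * (v - 17 / 20) * INR k2)) with (INR k2 * (- (2 * PI * (v - 17 / 20)))) by ring.
    rewrite exp_INR_mul, <- Rpow_mult_distr; apply pow_incr; split.
    + apply Rmult_le_pos; [lra | left; apply exp_pos].
    + apply Rle_trans with (exp v * exp (- (2 * PI * (v - 17 / 20)))).
      * apply Rmult_le_compat_r; [left; apply exp_pos | generalize (exp_ineq1_le v); lra].
      * rewrite <- exp_plus; apply exp_le_compat.
        assert (1 * v <= 2 * PI * v) by (apply Rmult_le_compat_r; lra); lra. }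
intros t l u ht.
destruct (nearest_int (Cre l)) as [a ha]; destruct (nearest_int (Cim l)) as [b hb].
rewrite <- (petersson_translate m k2 f (- a) (- b)); [ | apply Htr | unfold inH; lra].
apply Hmain; auto; unfold gauss; cbn [Cadd Cre Cim fst snd]; rewrite opp_IZR; auto.
Qed.

Lemma coef_le_of_pet_bound m k2 c f S y : (0 < m)%nat -> jseries m c f -> 0 < y ->
  (forall t l u, y <= Cim t -> petersson m k2 f t l u <= S) ->
  forall i, In (snd i) (suppList m (fst i)) ->
  Cnorm (c i) * (y ^ k2 * exp (- (2 * PI * y * disc m i))) <= S.
Proof.
intros hm H hy HS i hi.
assert (hm' : 0 < INR m) by (apply lt_0_INR; auto).
set (t := (0, y) : CC).
(* This is [l = - conj(r)/m], the centre of the Gaussian, where the exponent of the term equals its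
   discriminant. *)
set (l := (- IZR (fst (snd i)) / (2 * INR m), IZR (snd (snd i)) / (2 * INR m)) : CC).
set (E := exp (- (2 * PI * INR m * (Nrm2 l * y)))).
assert (hE : 0 < E) by apply exp_pos.
assert (hyk : 0 < y ^ k2) by (apply pow_lt; auto).
assert (h : Cnorm (c i * e (phase i t (l * t + C0) (Cconj l * t + Cconj C0)))%CC <= S / (y ^ k2 * E)).
{ apply (jseries_coef_bound m c f); auto.
  intros x w.
  (* A real shift of [t] is compensated in [u], so that [l] stays at the centre while [w] varies
     freely. *)
  assert (h := HS (t + RtoC x)%CC l (w - l * RtoC x)%CC); unfold petersson in h.
  replace (l * (t + RtoC x) + (w - l * RtoC x))%CC with (l * t + C0 + w)%CC in h by ring.
  replace (Cconj l * (t + RtoC x) + Cconj (w - l * RtoC x))%CC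
    with (Cconj l * t + Cconj C0 + Cconj w)%CC in h
    by (clearbody l t; apply CC_ext; cc_unfold; ring).
  replace (Cim (t + RtoC x)%CC) with y in h by (unfold t; cc_unfold; ring).
  specialize (h (Rle_refl y)); fold E in h.
  apply Rmult_le_reg_r with (y ^ k2 * E); [nra | ].
  replace (S / (y ^ k2 * E) * (y ^ k2 * E)) with S by (field; lra).
  rewrite <- Rmult_assoc; auto. }
rewrite Cnorm_term in h; change (Cim t) with y in h.
apply Rmult_le_compat_r with (r := y ^ k2 * E) in h; [ | nra].
replace (S / (y ^ k2 * E) * (y ^ k2 * E)) with S in h by (field; lra).
apply Rle_trans with (2 := h); right.
replace (exp (- (2 * PI * y * disc m i))) with (exp (- (2 * PI * (lin i l * y))) * E); [ring | ].
unfold E; rewrite <- exp_plus; f_equal.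
transitivity (- (2 * PI * y * expo m i l)); [unfold expo; ring | do 2 f_equal].
rewrite expo_disc by auto; unfold l; cbn [Cre Cim fst snd]; field; lra.
Qed.

(** * Gaussian and geometric sums *)

Lemma gaussian_sum_le (a s : R) (M : Z) : 0 < a ->
  RS (fun z => exp (- (a * ((IZR z + s) * (IZR z + s))))) (zrange M) <= 2 / (1 - exp (- a)).
Proof.
(* [H] is the primitive of [a exp(-a |t|)] that rises from 0 to 2. Its increment over
   [[t - 1/2, t + 1/2]] dominates the Gaussian at [t], so the sum telescopes with a bound
   independent of the shift [s]. *)
intros ha; set (H := fun t => if Rle_dec t 0 then exp (a * t) else 2 - exp (- (a * t))).
assert (hneg : forall t, t <= 0 -> H t = exp (a * t)).
{ intros t ht; unfold H; destruct (Rle_dec t 0); tauto. }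
assert (hpos : forall t, 0 <= t -> H t = 2 - exp (- (a * t))).
{ intros t ht; unfold H; destruct (Rle_dec t 0); auto.
  replace t with 0 by lra; rewrite Rmult_0_r, Ropp_0, exp_0; ring. }
assert (hb : forall t, 0 <= H t <= 2).
{ intros t; destruct (Rle_lt_dec t 0) as [h | h].
  - rewrite hneg by auto; generalize (exp_pos (a * t)) (exp_le_compat (a * t) 0); rewrite exp_0.
    intros; assert (a * t <= 0) by nra; lra.
  - rewrite hpos by lra; generalize (exp_pos (- (a * t))) (exp_le_compat (- (a * t)) 0); rewrite exp_0.
    intros; assert (- (a * t) <= 0) by nra; lra. }
assert (he : exp (- a) < 1) by (rewrite <- exp_0; apply exp_increasing; lra).
assert (hstep : forall t, (1 - exp (- a)) * exp (- (a * (t * t))) <= H (t + / 2) - H (t - / 2)).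
{ intros t; destruct (Rle_lt_dec (/ 2) t) as [h1 | h1].
  - rewrite !hpos by lra.
    replace (exp (- (a * (t + / 2)))) with (exp (- (a * (t - / 2))) * exp (- a))
      by (rewrite <- exp_plus; f_equal; field).
    assert (exp (- (a * (t * t))) <= exp (- (a * (t - / 2)))).
    { apply exp_le_compat, Ropp_le_contravar, Rmult_le_compat_l; [lra | nra]. }
    nra.
  - destruct (Rle_lt_dec t (- / 2)) as [h2 | h2].
    + rewrite !hneg by lra.
      replace (exp (a * (t - / 2))) with (exp (a * (t + / 2)) * exp (- a))
        by (rewrite <- exp_plus; f_equal; field).
      assert (exp (- (a * (t * t))) <= exp (a * (t + / 2))).
      { apply exp_le_compat; assert (0 <= a * (t * t + (t + / 2))) by (apply Rmult_le_pos; nra); lra. }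
      nra.
    + rewrite hpos, hneg by lra.
      (* Across the origin the increment is [2 - A - B] with [A B = exp(-a)]; it is at least
         [1 - A B] because [(1 - A)(1 - B) >= 0]. *)
      assert (hA : exp (- (a * (t + / 2))) <= 1) by (rewrite <- exp_0; apply exp_le_compat; nra).
      assert (hB : exp (a * (t - / 2)) <= 1) by (rewrite <- exp_0; apply exp_le_compat; nra).
      assert (hAB : exp (- (a * (t + / 2))) * exp (a * (t - / 2)) = exp (- a))
        by (rewrite <- exp_plus; f_equal; field).
      assert (exp (- (a * (t * t))) <= 1).
      { rewrite <- exp_0; apply exp_le_compat; assert (0 <= a * (t * t)) by (apply Rmult_le_pos; nra); lra. }
      nra. }
unfold zrange; rewrite RS_map.
set (n := Z.to_nat (2 * M + 1)).
assert (hsum : (1 - exp (- a)) * RS (fun i => exp (- (a * ((IZR (Z.of_nat i - M) + s) *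
    (IZR (Z.of_nat i - M) + s))))) (seq 0 n) <=
  H (IZR (Z.of_nat n - M) + s - / 2) - H (IZR (- M) + s - / 2)).
{ induction n as [ | n IH].
  - cbn [seq]; unfold RS; cbn [map fold_right]; rewrite Z.sub_0_l; lra.
  - rewrite seq_S, RS_app; cbn [Nat.add].
    specialize (hstep (IZR (Z.of_nat n - M) + s)).
    replace (IZR (Z.of_nat (S n) - M) + s - / 2) with (IZR (Z.of_nat n - M) + s + / 2).
    2:{ replace (Z.of_nat (S n) - M)%Z with ((Z.of_nat n - M) + 1)%Z by lia; rewrite plus_IZR; lra. }
    unfold RS at 2; cbn [map fold_right]; lra. }
apply Rmult_le_reg_l with (1 - exp (- a)); [lra | ].
replace ((1 - exp (- a)) * (2 / (1 - exp (- a)))) with 2 by (field; lra).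
generalize (hb (IZR (Z.of_nat n - M) + s - / 2)) (hb (IZR (- M) + s - / 2)); lra.
Qed.

(** Truncating [exp(-h t)] at its value in [X] gives a decreasing function to telescope against. The
    bound does not involve the offset [q], which will be N(r)/m. *)
Lemma geometric_tail_le (h X q : R) (n : nat) : 0 < h ->
  RS (fun i => if Rle_dec X (INR i - q) then exp (- (h * (INR i - q))) else 0) (seq 0 n)
  <= exp (- (h * X)) / (1 - exp (- h)).
Proof.
intros hh; set (T := fun t => Rmin (exp (- (h * X))) (exp (- (h * t)))).
assert (he : exp (- h) < 1) by (rewrite <- exp_0; apply exp_increasing; lra).
assert (hstep : forall t, (1 - exp (- h)) * (if Rle_dec X t then exp (- (h * t)) else 0) <=
  T t - T (t + 1)).
{ intros t; destruct (Rle_dec X t) as [hX | hX]; unfold T.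
  - rewrite !Rmin_right by (apply exp_le_compat; nra).
    replace (exp (- (h * (t + 1)))) with (exp (- (h * t)) * exp (- h))
      by (rewrite <- exp_plus; f_equal; ring); lra.
  - assert (exp (- (h * (t + 1))) <= exp (- (h * t))) by (apply exp_le_compat; nra).
    generalize (Rle_min_compat_l _ _ (exp (- (h * X))) H); lra. }
assert (hsum : (1 - exp (- h)) * RS (fun i => if Rle_dec X (INR i - q)
    then exp (- (h * (INR i - q))) else 0) (seq 0 n) <= T (0 - q) - T (INR n - q)).
{ induction n as [ | n IH].
  - unfold RS; cbn; lra.
  - rewrite seq_S, RS_app; cbn [Nat.add]; specialize (hstep (INR n - q)).
    rewrite S_INR; replace (INR n + 1 - q) with (INR n - q + 1) by ring.
    unfold RS at 2; cbn [map fold_right]; lra. }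
apply Rmult_le_reg_l with (1 - exp (- h)); [lra | ].
replace ((1 - exp (- h)) * (exp (- (h * X)) / (1 - exp (- h)))) with (exp (- (h * X))) by (field; lra).
assert (T (0 - q) <= exp (- (h * X))) by apply Rmin_l.
assert (0 <= T (INR n - q)) by (apply Rmin_glb; left; apply exp_pos).
lra.
Qed.

Lemma RS_list_prod_iter {A B} (g : A * B -> R) (l : list A) (l' : list B) :
  RS g (list_prod l l') = RS (fun a => RS (fun b => g (a, b)) l') l.
Proof.
induction l as [ | a l IH]; [reflexivity | ].
cbn [list_prod]; rewrite RS_app, RS_map, IH; reflexivity.
Qed.

(** Positivity allows the index set to be enlarged to a box. For fixed r the sum over n is then a
    geometric tail with a bound free of r, after which x and y decouple into two Gaussian sums. *)
Lemma theta_sum_le m N (h a X s1 s2 : R) : (0 < m)%nat -> 0 < h -> 0 < a ->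
  RS (fun i => (if Rle_dec X (disc m i) then exp (- (h * disc m i)) else 0) *
    (exp (- (a * ((IZR (fst (snd i)) + s1) * (IZR (fst (snd i)) + s1)))) *
     exp (- (a * ((IZR (snd (snd i)) + s2) * (IZR (snd (snd i)) + s2)))))) (idx m N)
  <= exp (- (h * X)) / (1 - exp (- h)) * (2 / (1 - exp (- a)) * (2 / (1 - exp (- a)))).
Proof.
intros hm hh ha.
set (gx := fun z => exp (- (a * ((IZR z + s1) * (IZR z + s1))))).
set (gy := fun z => exp (- (a * ((IZR z + s2) * (IZR z + s2))))).
set (gn := fun i : Ix => if Rle_dec X (disc m i) then exp (- (h * disc m i)) else 0).
change (RS (fun i => gn i * (gx (fst (snd i)) * gy (snd (snd i)))) (idx m N) <=
  exp (- (h * X)) / (1 - exp (- h)) * (2 / (1 - exp (- a)) * (2 / (1 - exp (- a))))).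
assert (hgx : forall z, 0 < gx z) by (intros; apply exp_pos).
assert (hgy : forall z, 0 < gy z) by (intros; apply exp_pos).
assert (hgn : forall i, 0 <= gn i).
{ intros i; unfold gn; destruct (Rle_dec X (disc m i)); [left; apply exp_pos | lra]. }
set (Z0 := zrange (4 * Z.of_nat N * Z.of_nat m)).
set (G := exp (- (h * X)) / (1 - exp (- h))).
assert (hG : 0 < G).
{ apply Rdiv_lt_0_compat; [apply exp_pos | ].
  assert (exp (- h) < 1) by (rewrite <- exp_0; apply exp_increasing; lra); lra. }
apply Rle_trans with (RS (fun i => gn i * (gx (fst (snd i)) * gy (snd (snd i))))
  (list_prod (seq 0 (S N)) (list_prod Z0 Z0))).
{ apply RS_incl; [apply NoDup_idx | | ].
  - intros [n [x y]] hi; apply in_idx in hi; cbn [fst snd] in hi; destruct hi as [h1 h2].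
    apply in_suppList in h2; apply in_prod_iff; split; [apply in_seq; lia | ].
    assert (4 * Z.of_nat n * Z.of_nat m <= 4 * Z.of_nat N * Z.of_nat m)%Z
      by (apply Z.mul_le_mono_nonneg_r; lia).
    assert (Z.abs x <= x * x /\ Z.abs y <= y * y)%Z by nia.
    apply in_prod_iff; unfold Z0; rewrite !in_zrange; lia.
  - intros i; apply Rmult_le_pos; auto; left; apply Rmult_lt_0_compat; auto. }
unfold Ix; rewrite RS_list_prod_iter, RS_exchange; cbn [fst snd].
apply Rle_trans with (RS (fun p => G * (gx (fst p) * gy (snd p))) (list_prod Z0 Z0)).
{ apply RS_le; intros [x y] _; cbn [fst snd].
  rewrite (RS_ext _ (fun n => (gx x * gy y) * gn (n, (x, y)))) by (intros; ring).
  rewrite RS_scal, Rmult_comm; apply Rmult_le_compat_r.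
  - left; apply Rmult_lt_0_compat; auto.
  - unfold gn, disc; cbn [fst snd]; apply geometric_tail_le; auto. }
rewrite RS_scal, RS_list_prod; apply Rmult_le_compat_l; [lra | ].
apply Rmult_le_compat; try (apply RS_ge0; intros; left; auto); apply gaussian_sum_le; auto.
Qed.

(** * Contraction *)

(** 290 lies below [(133/100)^20], and [exp (33/100) >= 133/100]. It is applied with [m^2] in place
    of [M], to absorb the order [m^2] of the theta sum. *)
Lemma exp_growth M : 1 <= M -> 290 * M <= exp (33 / 5 * M).
Proof.
intros hM.
assert (h0 : exp (33 / 5) = exp (33 / 100) ^ 20).
{ rewrite <- exp_INR_mul; f_equal; rewrite INR_IZR_INZ; cbn [Z.of_nat Pos.of_succ_nat Pos.succ]; lra. }
assert (h1 : 290 <= exp (33 / 5)).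
{ rewrite h0; apply Rle_trans with ((133 / 100) ^ 20); [lra | ].
  apply pow_incr; generalize (exp_ineq1_le (33 / 100)); lra. }
replace (33 / 5 * M) with (33 / 5 + 33 / 5 * (M - 1)) by ring; rewrite exp_plus.
apply Rle_trans with (290 * (1 + 33 / 5 * (M - 1))); [lra | ].
generalize (exp_ineq1_le (33 / 5 * (M - 1))); intros h2.
apply Rmult_le_compat; lra.
Qed.

Lemma one_minus_exp_bound a b : 0 < b <= a -> b / (1 + b) <= 1 - exp (- a).
Proof.
intros h; assert (h1 : exp (- a) <= exp (- b)) by (apply exp_le_compat; lra).
assert (h2 := exp_ineq1_le b); assert (h3 : exp b * exp (- b) = 1).
{ rewrite <- exp_plus, <- exp_0; f_equal; ring. }
assert (h4 := exp_pos (- b)).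
apply Rle_trans with (1 - exp (- b)); [ | lra].
apply Rmult_le_reg_r with (1 + b); [lra | ].
unfold Rdiv; rewrite Rmult_assoc, Rinv_l, Rmult_1_r by lra; nra.
Qed.

(** Each Gaussian sum is of order [m] at most, so the left side is essentially [Q^k2 m^2], where
    [Q = (v / (3/10)) exp(-h m^2)]. As [Q <= 1] and [k2 >= 2], it is enough to bound [Q^2 m^2]. *)
Lemma contraction_factor k2 m v : (2 <= k2)%nat -> (0 < m)%nat -> 17 / 20 <= v ->
  let h := 2 * PI * (v - 3 / 10) in
  let a := 2 * PI * v / (4 * INR m) in
  let X := INR k2 * (INR m * INR m) in
  v ^ k2 / (3 / 10) ^ k2 *
    (exp (- (h * X)) / (1 - exp (- h)) * (2 / (1 - exp (- a)) * (2 / (1 - exp (- a))))) <= / 2.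
Proof.
intros hk hm hv h a X; assert (hP := two_PI_gt_6).
set (M := INR m) in *; assert (hM : 1 <= M) by (apply (le_INR 1); auto).
assert (hMM : M <= M * M) by nra.
(* The rational constants come from [2 pi > 6]: here [33/10 = 6 (17/20 - 3/10)], and below
   [51/40 = 6 (17/20) / 4]. *)
assert (hh : 33 / 10 <= h).
{ unfold h; replace (33 / 10) with (6 * (11 / 20)) by lra; apply Rmult_le_compat; lra. }
assert (ha : 51 / 40 / M <= a).
{ unfold a; apply Rmult_le_reg_r with (4 * M); [lra | ].
  replace (51 / 40 / M * (4 * M)) with (6 * (17 / 20)) by (field; lra).
  replace (2 * PI * v / (4 * M) * (4 * M)) with (2 * PI * v) by (field; lra).
  apply Rmult_le_compat; lra. }
assert (hgeo : 33 / 43 <= 1 - exp (- h)).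
{ assert (E := one_minus_exp_bound h (33 / 10)); lra. }
assert (hgau : 51 / 91 / M <= 1 - exp (- a)).
{ assert (hp : 0 < 51 / 40 / M) by (apply Rdiv_lt_0_compat; lra).
  apply Rle_trans with (2 := one_minus_exp_bound a _ (conj hp ha)).
  replace (51 / 40 / M / (1 + 51 / 40 / M)) with (51 / (40 * M + 51)) by (field; lra).
  replace (51 / 91 / M) with (51 / (91 * M)) by (field; lra).
  apply Rmult_le_compat_l; [lra | apply Rinv_le_contravar; lra]. }
set (Q := v / (3 / 10) * exp (- (h * (M * M)))).
set (W := exp (33 / 10 * (M * M))).
assert (hW : 0 < W) by apply exp_pos.
assert (hWW : 290 * (M * M) <= W * W).
{ unfold W; rewrite <- exp_plus.
  replace (33 / 10 * (M * M) + 33 / 10 * (M * M)) with (33 / 5 * (M * M)) by field.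
  apply exp_growth; lra. }
assert (hQ0 : 0 <= Q).
{ apply Rmult_le_pos; [ | left; apply exp_pos]; left; apply Rdiv_lt_0_compat; lra. }
(* 17/6 is the value of [v / (3/10)] at [v = 17/20]. Growth beyond that height is at most
   [exp (6 (v - 17/20))], which the decay left over after [W] cancels since [m^2 >= 1]. *)
assert (hQ : Q * W <= 17 / 6).
{ unfold Q, W; rewrite Rmult_assoc, <- exp_plus.
  apply Rle_trans with (17 / 6 * exp (6 * (v - 17 / 20)) * exp (- (6 * (v - 17 / 20)))).
  - apply Rmult_le_compat.
    + left; apply Rdiv_lt_0_compat; lra.
    + left; apply exp_pos.
    + generalize (exp_ineq1_le (6 * (v - 17 / 20))); lra.
    + apply exp_le_compat.
      assert (6 * (v - 3 / 10) * (M * M) <= h * (M * M)).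
      { apply Rmult_le_compat_r; [lra | unfold h; apply Rmult_le_compat_r; lra]. }
      assert (6 * (v - 17 / 20) * 1 <= 6 * (v - 17 / 20) * (M * M)) by (apply Rmult_le_compat_l; lra).
      lra.
  - rewrite Rmult_assoc, <- exp_plus, Rplus_opp_r, exp_0; lra. }
assert (hQ1 : Q <= 1).
{ apply Rmult_le_reg_r with W; auto.
  assert (17 <= W) by (assert (290 <= W * W) by lra; nra). lra. }
assert (hQQ : Q * Q * (290 * (M * M)) <= 289 / 36).
{ apply Rle_trans with (Q * W * (Q * W)).
  - replace (Q * W * (Q * W)) with (Q * Q * (W * W)) by ring; apply Rmult_le_compat_l; nra.
  - assert (0 <= Q * W) by nra; nra. }
assert (hE : v ^ k2 / (3 / 10) ^ k2 * exp (- (h * X)) <= Q * Q).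
{ replace (- (h * X)) with (INR k2 * - (h * (M * M))) by (unfold X; ring).
  rewrite exp_INR_mul; unfold Rdiv at 1; rewrite <- pow_inv, <- !Rpow_mult_distr.
  change (Q ^ k2 <= Q * Q).
  replace k2 with (2 + (k2 - 2))%nat by lia; rewrite pow_add.
  assert (0 <= Q ^ (k2 - 2) <= 1).
  { split; [apply pow_le; auto | rewrite <- (pow1 (k2 - 2)); apply pow_incr; auto]. }
  cbn [pow]; nra. }
set (A := 1 - exp (- h)) in *; set (B := 1 - exp (- a)) in *.
assert (hA : / A <= 43 / 33).
{ replace (43 / 33) with (/ (33 / 43)) by lra; apply Rinv_le_contravar; lra. }
assert (hp : 0 < 51 / 91 / M) by (apply Rdiv_lt_0_compat; lra).
assert (hB : / B <= 91 / 51 * M).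
{ replace (91 / 51 * M) with (/ (51 / 91 / M)) by (field; lra); apply Rinv_le_contravar; lra. }
assert (hA0 : 0 < / A) by (apply Rinv_0_lt_compat; lra).
assert (hB0 : 0 < / B) by (apply Rinv_0_lt_compat; lra).
replace (v ^ k2 / (3 / 10) ^ k2 * (exp (- (h * X)) / A * (2 / B * (2 / B)))) with
  ((v ^ k2 / (3 / 10) ^ k2 * exp (- (h * X))) * (4 * / A * (/ B * / B))) by (unfold Rdiv; ring).
assert (hBB : / B * / B <= 91 / 51 * M * (91 / 51 * M)) by (apply Rmult_le_compat; lra).
assert (hC : 4 * / A * (/ B * / B) <= 4 * (43 / 33) * (91 / 51 * M * (91 / 51 * M))).
{ apply Rmult_le_compat; try lra; nra. }
apply Rle_trans with (Q * Q * (4 * (43 / 33) * (91 / 51 * M * (91 / 51 * M)))).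
- apply Rmult_le_compat; auto; [ | nra].
  apply Rmult_le_pos; [ | left; apply exp_pos].
  left; apply Rdiv_lt_0_compat; apply pow_lt; lra.
- replace (Q * Q * (4 * (43 / 33) * (91 / 51 * M * (91 / 51 * M)))) with
    (Q * Q * (290 * (M * M)) * (4 * (43 / 33) * (91 / 51) * (91 / 51) / 290)) by field.
  lra.
Qed.

Lemma petersson_contract m k2 c f S : (0 < m)%nat -> (2 <= k2)%nat -> jseries m c f ->
  (forall b t z1 z2, inH t -> slashM (2 * k2) m C1 0 (-1) 1 b f t z1 z2 = f t z1 z2) ->
  (forall i, In (snd i) (suppList m (fst i)) -> c i <> C0 ->
     INR k2 * (INR m * INR m) <= disc m i) ->
  (forall t l u, 17 / 20 <= Cim t -> petersson m k2 f t l u <= S) ->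
  forall t l u, 17 / 20 <= Cim t -> petersson m k2 f t l u <= S * / 2.
Proof.
intros hm hk H Hinv hlow HS t l u ht; assert (hP := two_PI_gt_6).
set (v := Cim t) in *; set (X := INR k2 * (INR m * INR m)) in *.
assert (hv : inH t) by (unfold inH; fold v; lra).
assert (hm' : 0 < INR m) by (apply lt_0_INR; auto).
assert (hc := coef_le_of_pet_bound m k2 c f S (3 / 10) hm H ltac:(lra)
  (petersson_descend m k2 f S Hinv HS)).
assert (hS : 0 <= S).
{ apply Rle_trans with (2 := HS t l u ht); unfold petersson; fold v.
  repeat apply Rmult_le_pos; [apply Cnorm_ge0 | apply pow_le; lra | left; apply exp_pos]. }
set (a := 2 * PI * v / (4 * INR m)); set (h := 2 * PI * (v - 3 / 10)).
set (y := (3 / 10) ^ k2) in *; assert (hy : 0 < y) by (apply pow_lt; lra).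
set (s1 := 2 * INR m * Cre l); set (s2 := - (2 * INR m * Cim l)).
set (C := exp (- (h * X)) / (1 - exp (- h)) * (2 / (1 - exp (- a)) * (2 / (1 - exp (- a))))).
apply Rle_trans with (v ^ k2 * (S / y * C)).
2:{ replace (v ^ k2 * (S / y * C)) with (S * (v ^ k2 / y * C)) by (field; lra).
    apply Rmult_le_compat_l; auto; apply contraction_factor; auto. }
apply (petersson_le_series m k2 c); auto; intros N; fold v.
apply Rle_trans with (S / y * RS (fun i =>
  (if Rle_dec X (disc m i) then exp (- (h * disc m i)) else 0) *
    (exp (- (a * ((IZR (fst (snd i)) + s1) * (IZR (fst (snd i)) + s1)))) *
     exp (- (a * ((IZR (snd (snd i)) + s2) * (IZR (snd (snd i)) + s2)))))) (idx m N)).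
2:{ apply Rmult_le_compat_l; [apply Rmult_le_pos; [auto | left; apply Rinv_0_lt_compat; auto] | ].
    apply theta_sum_le; auto; [unfold h; apply Rmult_lt_0_compat; lra | ].
    unfold a; apply Rdiv_lt_0_compat; [apply Rmult_lt_0_compat; lra | lra]. }
rewrite <- RS_scal; apply RS_le; intros i hi; apply in_idx in hi; destruct hi as [_ hi].
set (gx := exp (- (a * ((IZR (fst (snd i)) + s1) * _)))).
set (gy := exp (- (a * ((IZR (snd (snd i)) + s2) * _)))).
assert (hgx : 0 < gx) by apply exp_pos; assert (hgy : 0 < gy) by apply exp_pos.
assert (hSy : 0 <= S / y) by (apply Rmult_le_pos; [auto | left; apply Rinv_0_lt_compat; auto]).
assert (hgg : 0 < gx * gy) by (apply Rmult_lt_0_compat; auto).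
destruct (Req_dec (Cnorm (c i)) 0) as [E | E].
{ rewrite E, Rmult_0_l; apply Rmult_le_pos; auto; apply Rmult_le_pos; [ | lra].
  destruct (Rle_dec X (disc m i)); [left; apply exp_pos | lra]. }
destruct (Rle_dec X (disc m i)) as [hX | hX].
2:{ elim hX; apply hlow; auto; intros E'; apply E; rewrite E'; apply Cnorm_C0. }
specialize (hc i hi).
set (p := exp (- (2 * PI * (3 / 10) * disc m i))) in *.
assert (hp : 0 < p) by apply exp_pos.
(* Only the discriminant part of the exponent is split at height 3/10, where the coefficient bound
   uses up [p]; the Gaussian keeps the full height v. *)
replace (exp (- (2 * PI * v * expo m i l))) with (p * exp (- (h * disc m i)) * (gx * gy)).
2:{ unfold p, gx, gy; rewrite <- !exp_plus; f_equal; rewrite expo_disc by auto.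
    unfold h, a, s1, s2; field; lra. }
rewrite <- !Rmult_assoc; apply Rmult_le_compat_r; [lra | apply Rmult_le_compat_r; [lra | ]].
apply Rmult_le_compat_r; [left; apply exp_pos | ].
apply Rmult_le_reg_r with y; auto; unfold Rdiv; rewrite (Rmult_assoc S), Rinv_l, Rmult_1_r by lra.
lra.
Qed.

Lemma le_halves_le0 a S : (forall n, a <= S * (/ 2) ^ n) -> a <= 0.
Proof.
intros H; apply Rnot_lt_le; intros ha.
assert (hS : 0 < S) by (specialize (H 0%nat); cbn in H; lra).
destruct (pow_lt_1_zero (/ 2)) with (y := a / S) as [N HN].
- rewrite Rabs_right; lra.
- apply Rdiv_lt_0_compat; auto.
- specialize (HN N (le_n N)); specialize (H N).
  assert (hp : 0 < (/ 2) ^ N) by (apply pow_lt; lra).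
  rewrite Rabs_right in HN by lra.
  apply Rmult_lt_compat_l with (r := S) in HN; auto.
  replace (S * (a / S)) with a in HN by (field; lra); lra.
Qed.

Lemma low_vanishing_zero m k2 c f : (0 < m)%nat -> (2 <= k2)%nat -> jseries m c f ->
  (forall b t z1 z2, inH t -> slashM (2 * k2) m C1 0 (-1) 1 b f t z1 z2 = f t z1 z2) ->
  (forall a b t z1 z2, inH t -> slashH m (gauss a b) (gauss 0 0) f t z1 z2 = f t z1 z2) ->
  (forall i, In (snd i) (suppList m (fst i)) -> c i <> C0 ->
     INR k2 * (INR m * INR m) <= disc m i) ->
  forall t z1 z2, inH t -> f t z1 z2 = C0.
Proof.
intros hm hk H Hinv Htr hlow.
assert (hlow' : forall i, In (snd i) (suppList m (fst i)) -> c i <> C0 -> INR k2 <= disc m i).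
{ intros i hi hne; apply Rle_trans with (2 := hlow i hi hne).
  assert (1 <= INR m) by (apply (le_INR 1); auto); assert (h := pos_INR k2).
  assert (1 <= INR m * INR m) by nra; nra. }
destruct (petersson_bounded m k2 c f hm H Htr hlow') as [S HS].
assert (HSn : forall n t l u, 17 / 20 <= Cim t -> petersson m k2 f t l u <= S * (/ 2) ^ n).
{ induction n as [ | n IH]; [cbn; rewrite Rmult_1_r; auto | ].
  replace (S * (/ 2) ^ Datatypes.S n) with (S * (/ 2) ^ n * / 2) by (cbn; ring).
  apply (petersson_contract m k2 c); auto. }
assert (hc : forall i, In (snd i) (suppList m (fst i)) -> c i = C0).
{ intros i hi; apply Cnorm_eq0, Rle_antisym; [ | apply Cnorm_ge0].
  set (w := (17 / 20) ^ k2 * exp (- (2 * PI * (17 / 20) * disc m i))).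
  assert (hw : 0 < w) by (apply Rmult_lt_0_compat; [apply pow_lt; lra | apply exp_pos]).
  apply Rmult_le_reg_r with w; auto; rewrite Rmult_0_l.
  apply (le_halves_le0 _ S); intros n.
  apply (coef_le_of_pet_bound m k2 c f); auto; lra. }
intros t z1 z2 ht; destruct (H t z1 z2 ht) as [_ hC].
apply Cnorm_eq0, Rle_antisym; [ | apply Cnorm_ge0].
apply (Ccv_le _ _ _ hC); intros N; rewrite CS_zero; [rewrite Cnorm_C0; lra | ].
intros i hi; apply in_idx in hi; rewrite hc by tauto; ring.
Qed.

Lemma disc_lower m k2 i : (0 < m)%nat ->
  (4 * Z.of_nat m * Z.of_nat m * Z.of_nat m * Z.of_nat k2 <= 4 * Z.of_nat (fst i) * Z.of_nat m -
    (fst (snd i) * fst (snd i) + snd (snd i) * snd (snd i)))%Z ->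
  INR k2 * (INR m * INR m) <= disc m i.
Proof.
intros hm h; apply IZR_le in h.
rewrite minus_IZR, plus_IZR, !mult_IZR, <- !INR_IZR_INZ in h.
assert (hm' : 0 < INR m) by (apply lt_0_INR; auto).
apply Rmult_le_reg_r with (4 * INR m); [lra | unfold disc].
set (q := IZR _ * _ + _) in *.
replace ((INR (fst i) - q / (4 * INR m)) * (4 * INR m)) with (4 * INR (fst i) * INR m - q)
  by (field; lra).
lra.
Qed.

Theorem theorem6p6 (k m : nat) (hk : (0 < k)%nat) (hm : (0 < m)%nat)
  (hk4 : Nat.modulo k 4 = 0%nat)
  (phi psi : CC -> CC -> CC -> CC) (hphi : JSpez k m phi) (hpsi : JSpez k m psi)
  (hD : forall nu : nat, (nu <= Rzero k m)%nat ->
        forall t : CC, inH t -> Dnu k m nu phi t = Dnu k m nu psi t) :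
  forall t z1 z2 : CC, inH t -> phi t z1 z2 = psi t z1 z2.
Proof.
destruct hphi as ((_ & Mphi & Hphi & _) & cphi & Fphi & Sphi).
destruct hpsi as ((_ & Mpsi & Hpsi & _) & cpsi & Fpsi & Spsi).
apply jseries_of_has_fourier in Fphi; apply jseries_of_has_fourier in Fpsi.
set (c1 := fun i : Ix => cphi (fst i) (fst (snd i)) (snd (snd i))) in *.
set (c2 := fun i : Ix => cpsi (fst i) (fst (snd i)) (snd (snd i))) in *.
set (c := fun i => (c1 i + Copp (c2 i))%CC).
set (f := fun t z1 z2 => (phi t z1 z2 + Copp (psi t z1 z2))%CC).
assert (Hf : jseries m c f) by exact (jseries_add _ _ _ _ _ Fphi (jseries_opp _ _ _ Fpsi)).
set (k2 := (k / 2)%nat).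
(* Here [k = 0 mod 4] enters: evenness makes the power of [Im t] integral, and [k >= 4] gives the
   [2 <= k2] used both in the discriminant bound and in the contraction. *)
assert (hk2 : k = (2 * k2)%nat /\ (2 <= k2)%nat).
{ unfold k2; generalize (Nat.div_mod_eq k 4) (Nat.div_mod_eq k 2) (Nat.mod_upper_bound k 2); lia. }
destruct hk2 as [hk2 hk2']; clearbody k2.
assert (hsupp : forall i, In (snd i) (suppList m (fst i)) ->
  supp m (fst i) (fst (snd i)) (snd (snd i)) = true).
{ intros [n [x y]] h; apply in_suppList in h; unfold supp; cbn [fst snd] in *; apply Z.leb_le; lia. }
assert (hspez : forall i j, In (snd i) (suppList m (fst i)) -> In (snd j) (suppList m (fst j)) ->
    (4 * Z.of_nat (fst i) * Z.of_nat m - (fst (snd i) * fst (snd i) + snd (snd i) * snd (snd i)) =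
     4 * Z.of_nat (fst j) * Z.of_nat m - (fst (snd j) * fst (snd j) + snd (snd j) * snd (snd j)))%Z ->
    c i = c j).
{ intros i j hi hj E; unfold c, c1, c2.
  rewrite (Sphi (fst i) _ _ (fst j) _ _ (hsupp i hi) (hsupp j hj) E).
  rewrite (Spsi (fst i) _ _ (fst j) _ _ (hsupp i hi) (hsupp j hj) E); reflexivity. }
destruct (kappa_bounds k m hk hm) as [_ hkap].
assert (hlowc : forall i, (Z.of_nat (fst i) <= kappa k m)%Z ->
  In (snd i) (suppList m (fst i)) -> c i = C0).
{ intros i0 hn hi0.
  apply (block_coeffs_zero k m (fst i0)); auto.
  - intros nu hnu.
    (* [hD] compares the operators on [phi] and [psi] separately, so the subtraction is made between
       their q-series; this avoids arguing about additivity of the [epsilon]-defined [Cderiv]. *)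
    refine (qseries_zero_block m _ _ (qseries_ext _ _ _ _ _ (qseries_sub _ _ _ _ _
      (Dtilde_qseries k m _ _ Fphi nu 0) (Dtilde_qseries k m _ _ Fpsi nu 0))) _ (fst i0)).
    + intros i; unfold c; ring.
    + intros t ht; specialize (hD nu hnu t ht); unfold Dnu in hD; rewrite hD; ring.
  - intros i j hi hj h1 h2 E; apply hspez; rewrite ?hi, ?hj; auto.
    rewrite (sig_inj _ _ E); reflexivity. }
assert (hlow : forall i, In (snd i) (suppList m (fst i)) -> c i <> C0 ->
     INR k2 * (INR m * INR m) <= disc m i).
{ intros i hi hne; apply disc_lower; auto.
  assert (h := low_discriminant_zero m c (kappa k m) hm hspez hlowc i hi hne).
  apply Z.le_trans with (2 := h); clear h; clear - hkap hk2 hk2' hm.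
  set (K := kappa k m) in *; clearbody K; subst k.
  set (M := Z.of_nat m) in *; set (q := Z.of_nat k2).
  replace (Z.of_nat (2 * k2)) with (2 * q)%Z in hkap by lia.
  assert (hM : (0 < M)%Z) by lia; assert (hq : (2 <= q)%Z) by lia.
  (* Up to a common factor [h1] says [3 q <= 2 (2 q - 1)], that is [q >= 2]; the summand [3 * M] in
     [h2] covers the [2 M^2] lost in the reduction. *)
  assert (h1 : (4 * M * M * q * 3 <= 2 * (4 * M * M * (2 * q - 1)))%Z) by nia.
  assert (h2 : (M * (4 * M * M * (2 * q - 1) + 3 * M) <= M * (6 * (K + 1)))%Z) by nia.
  nia. }
assert (hz : forall t z1 z2, inH t -> f t z1 z2 = C0).
{ apply (low_vanishing_zero m k2 c); auto.
  - intros b t z1 z2 ht; rewrite <- hk2; unfold f, slashM; cbv zeta.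
    assert (h1 := Mphi C1 0%Z (-1)%Z 1%Z b (or_introl eq_refl) eq_refl t z1 z2 ht).
    assert (h2 := Mpsi C1 0%Z (-1)%Z 1%Z b (or_introl eq_refl) eq_refl t z1 z2 ht).
    rewrite <- h1, <- h2; unfold slashM; cbv zeta; ring.
  - intros a b t z1 z2 ht; unfold f, slashH.
    rewrite <- (Hphi a b 0%Z 0%Z t z1 z2 ht), <- (Hpsi a b 0%Z 0%Z t z1 z2 ht); unfold slashH; ring. }
intros t z1 z2 ht; specialize (hz t z1 z2 ht); unfold f in hz.
replace (phi t z1 z2) with ((phi t z1 z2 + Copp (psi t z1 z2)) + psi t z1 z2)%CC by ring.
rewrite hz; ring.
Qed.
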